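(* Let $R\supseteq\mathbb{R}$ be a real closed field. Then an $\mathbb{R}$-algebra homomorphism $\phi:T_n\to R$ extends to an $\mathbb{R}$-algebra homomorphism $\mathbb{R}[\boldsymbol\xi]\to R$ if and only if $\phi(\operatorname{tr}(hh^{\mathsf t}))\ge0$ for all $h\in\mathbb{T}_n$.
   Context: Fix $g,n\in\mathbb{N}$. Let $\boldsymbol{\xi}=\{\xi_{jpq}:1\le j\le g,\ 1\le p,q\le n\}$ be commuting indeterminates and $\Xi_j=(\xi_{jpq})_{p,q}\in M_n(\mathbb{R}[\boldsymbol\xi])$ the generic $n\times n$ matrices. The trace ring $\mathbb{T}_n\subset M_n(\mathbb{R}[\boldsymbol\xi])$ is the $\mathbb{R}$-subalgebra generated by all $\Xi_j$, their transposes $\Xi_j^{\mathsf t}$, and the traces (viewed as scalar matrices) of products of these. It carries the transpose involution $\mathsf t$ and the trace $\operatorname{tr}$. Its center is $T_n\subset\mathbb{R}[\boldsymbol\xi]$ (identified with scalar matrices). *)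

(* Defs.v *)
From HB Require Import structures.
From mathcomp Require Import all_boot all_order all_algebra.
From mathcomp Require Import boolp reals.
From mathcomp Require Import mpoly.

Set Implicit Arguments.
Unset Strict Implicit.
Unset Printing Implicit Defensive.

Import GRing.Theory.
Local Open Scope ring_scope.

(* R[xi]: the variables are numbered through the enumeration of the finite
   type of triples (j, p, q). *)
Definition xi_index (g n : nat) : finType := ('I_g * 'I_n * 'I_n)%type.

Notation xi_poly R g n := {mpoly R[#|xi_index g n|]}.

Definition xi (R : realType) (g n : nat) (j : 'I_g) (p q : 'I_n) :
  xi_poly R g n := 'X_(enum_rank ((j, p, q) : xi_index g n)).

Definition generic_mx (R : realType) (g n : nat) (j : 'I_g) :
  'M[xi_poly R g n]_n := \matrix_(p, q) xi R j p q.

(* A letter (j, false) stands for the generic matrix Xi_j and (j, true) for its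
   transpose. *)
Definition letter_mx (R : realType) (g n : nat) (l : 'I_g * bool) :
  'M[xi_poly R g n]_n :=
  if l.2 then (generic_mx R n l.1)^T else generic_mx R n l.1.

Definition word_mx (R : realType) (g n : nat) (w : seq ('I_g * bool)) :
  'M[xi_poly R g n]_n :=
  \big[mulmx/1%:M]_(l <- w) letter_mx R n l.

(* The R-subalgebra of n x n matrices over R[xi] generated by the letters and
   the traces of words, the latter viewed as scalar matrices. *)
Inductive trace_ring (R : realType) (g n : nat) : 'M[xi_poly R g n]_n -> Prop :=
| trace_ring_letter l : trace_ring (letter_mx R n l)
| trace_ring_trace w : trace_ring (\tr (word_mx R n w))%:M
| trace_ring_scalar (c : R) : trace_ring (c%:A : xi_poly R g n)%:M
| trace_ring_add a b : trace_ring a -> trace_ring b -> trace_ring (a + b)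
| trace_ring_mul a b : trace_ring a -> trace_ring b -> trace_ring (a *m b).

Definition trace_ring_center (R : realType) (g n : nat)
    (z : 'M[xi_poly R g n]_n) : Prop :=
  trace_ring z /\ forall h, trace_ring h -> z *m h = h *m z.

(* T_n: the polynomials whose scalar matrix is central in the trace ring. *)
Definition Tcenter_pred (R : realType) (g n : nat) : {pred xi_poly R g n} :=
  fun f => `[< trace_ring_center f%:M >].

Arguments Tcenter_pred : clear implicits.

Lemma Tcenter_predP (R : realType) (g n : nat) (f : xi_poly R g n) :
  reflect (trace_ring f%:M) (f \in Tcenter_pred R g n).
Proof.
apply: (iffP (asboolP _)) => [[] //|Tf]; split=> // h _.
by rewrite scalar_mxC.
Qed.

Fact Tcenter_subalg_closed (R : realType) (g n : nat) :
  GRing.subalg_closed (Tcenter_pred R g n).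
Proof.
split=> [|a f h /Tcenter_predP Tf /Tcenter_predP Th
         |f h /Tcenter_predP Tf /Tcenter_predP Th]; apply/Tcenter_predP.
- by have := trace_ring_scalar g n (1 : R); rewrite scale1r.
- rewrite raddfD /=; apply: trace_ring_add => //.
  rewrite -mulr_algl scalar_mxM; apply: trace_ring_mul => //.
  exact: trace_ring_scalar.
- by rewrite scalar_mxM; apply: trace_ring_mul.
Qed.

HB.instance Definition _ (R : realType) (g n : nat) :=
  GRing.isSubalgClosed.Build R (xi_poly R g n) (Tcenter_pred R g n)
    (Tcenter_subalg_closed R g n).

Record Tcenter (R : realType) (g n : nat) := MkTcenter {
  Tcenter_val :> xi_poly R g n;
  Tcenter_valP : Tcenter_val \in Tcenter_pred R g n }.

HB.instance Definition _ (R : realType) (g n : nat) :=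
  [isSub for @Tcenter_val R g n].
HB.instance Definition _ (R : realType) (g n : nat) :=
  [Choice of Tcenter R g n by <:].
HB.instance Definition _ (R : realType) (g n : nat) :=
  [SubChoice_isSubAlgebra of Tcenter R g n by <:].
HB.instance Definition _ (R : realType) (g n : nat) :=
  [SubNzRing_isSubComNzRing of Tcenter R g n by <:].

Lemma word_mx_cons (R : realType) (g n : nat) (l : 'I_g * bool) w :
  word_mx R n (l :: w) = letter_mx R n l *m word_mx R n w.
Proof. by rewrite /word_mx big_cons. Qed.

Lemma trace_ring_tr (R : realType) (g n : nat) (h : 'M[xi_poly R g n]_n) :
  trace_ring h -> trace_ring (\tr h)%:M.
Proof.
move=> Th.
suff Q (m : 'M[xi_poly R g n]_n) :
    (forall w, trace_ring (\tr (m *m word_mx R n w))%:M) ->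
    forall w, trace_ring (\tr (m *m h *m word_mx R n w))%:M.
  have T1 (w : seq ('I_g * bool)) : trace_ring (\tr (1%:M *m word_mx R n w))%:M.
    by rewrite mul1mx; apply: trace_ring_trace.
  have := Q _ T1 [::].
  by rewrite /word_mx big_nil mul1mx mulmx1.
elim: Th m => {h} [l|v|c|a b _ IHa _ IHb|a b _ IHa _ IHb] m Hm w.
- by rewrite -mulmxA -word_mx_cons.
- rewrite scalar_mxC -mulmxA mul_scalar_mx linearZ /= scalar_mxM.
  by apply: trace_ring_mul => //; apply: trace_ring_trace.
- rewrite scalar_mxC -mulmxA mul_scalar_mx linearZ /= scalar_mxM.
  by apply: trace_ring_mul => //; apply: trace_ring_scalar.
- rewrite mulmxDr mulmxDl !raddfD /=.
  by apply: trace_ring_add; [apply: IHa | apply: IHb].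
- by rewrite mulmxA; apply: IHb => v; apply: IHa.
Qed.

Lemma trace_ring_trmx (R : realType) (g n : nat) (h : 'M[xi_poly R g n]_n) :
  trace_ring h -> trace_ring h^T.
Proof.
elim=> {h} [[j b]|v|c|a b _ IHa _ IHb|a b _ IHa _ IHb].
- suff -> : (letter_mx R n (j, b))^T = letter_mx R n (j, ~~ b).
    exact: trace_ring_letter.
  by case: b; rewrite /letter_mx /= ?trmxK.
- by rewrite tr_scalar_mx; apply: trace_ring_trace.
- by rewrite tr_scalar_mx; apply: trace_ring_scalar.
- by rewrite raddfD /=; apply: trace_ring_add.
- by rewrite trmx_mul; apply: trace_ring_mul.
Qed.

Fact tr_mul_trmx_subproof (R : realType) (g n : nat)
    (h : 'M[xi_poly R g n]_n) :
  trace_ring h -> \tr (h *m h^T) \in Tcenter_pred R g n.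
Proof.
move=> Th; apply/Tcenter_predP/trace_ring_tr.
by apply: trace_ring_mul => //; apply: trace_ring_trmx.
Qed.

(* tr (h h^t), as an element of T_n. *)
Definition tr_mul_trmx (R : realType) (g n : nat) (h : 'M[xi_poly R g n]_n)
    (Th : trace_ring h) : Tcenter R g n :=
  MkTcenter (tr_mul_trmx_subproof Th).

(* Main.v *)
Require Import Defs.
From HB Require Import structures.
From mathcomp Require Import all_boot all_order all_algebra.
From mathcomp Require Import boolp reals.
From mathcomp Require Import mpoly.
From mathcomp Require Import complex ring lra.
From mathcomp Require classical_sets ring_quotient generic_quotient.
Import Order.TTheory GRing.Theory Num.Theory.
Local Open Scope ring_scope.

Set Implicit Arguments.
Unset Strict Implicit.
Unset Printing Implicit Defensive.

(** If phi extends to psi, then phi (tr (h h^t)) is the sum of the squares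
    psi (h_pq)^2. For the converse put t(w) = phi (tr w) for a word w in the
    generic matrices and their transposes. Traces of words generate T_n, so it
    is enough to find matrices Y_1, ..., Y_g over S such that the trace of
    w(Y, Y^t) is t(w) for all words w ([realization_extends]).

    Positivity supplies a Euclidean space. The form t(u v^t) on words is
    positive semidefinite over the subring phi(T_n), hence over S
    ([psd_mx_subring]), and has finite rank ([word_form_bound]). Modulo its
    isotropic vectors the words therefore span some S^m ([gram_realization]),
    on which letters act on the left by operators L and on the right by
    operators Q. The image of the empty word defines a positive trace tau on
    the commutant of L. Split the identity into minimal projections P of this
    commutant. The corner of each P is S, S[i] or the quaternions
    ([corner_basis_exists]), and averaging over the corner and over the
    projections equivalent to P expresses t(w) as the sum, over the classes of
    equivalent projections, of (tau P / d) tr (L_w P), where d is the dimension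
    of the corner ([corner_trace]). Compressing L to the images of the
    projections realizes t by an orthogonal direct sum, provided that d divides
    tau P in the natural numbers ([tracial_realizable]).

    This divisibility is where the size n matters. Forgetting positivity, phi
    is first realized by n x n matrices X over some field K containing S[i].
    For that, T_n is a direct summand of R[xi] as a T_n-module: its orthogonal
    complement for the Fischer inner product is stable under multiplication by
    tr w, because the adjoint of this multiplication is a contraction of
    partial derivatives, and contractions preserve the trace ring
    ([divergence_closed], [perp_trace], [reynolds_exists]). Hence the elements
    tr w - phi (tr w) generate a proper ideal of S[i][xi], and K is a residue field
    ([complex_point_exists]). Elements of the commutant lift to
    combinations of words in X having the prescribed traces. Idempotents lift
    to idempotents, so that tau P is a rank; an invertible skew element below
    an idempotent forces the rank to be even ([idempotent_state_even]). This
    settles the corner S[i]. In a quaternionic corner with units i, j, the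
    idempotent f = (P - sqrt(-1) i) / 2 has state tau P / 2, and j f is skew
    and invertible below f, so that 4 divides tau P
    ([liftings_divisibility]). *)

(** * Gram matrices over ordered fields *)

Definition psd_mx (F : numDomainType) k (G : 'M[F]_k) :=
  forall x : 'rV_k, 0 <= (x *m G *m x^T) 0 0.

Definition posdef_mx (F : numDomainType) k (G : 'M[F]_k) :=
  forall x : 'rV_k, x != 0 -> 0 < (x *m G *m x^T) 0 0.

Lemma mx11D (V : nmodType) (X Y : 'M[V]_1) : (X + Y) 0 0 = X 0 0 + Y 0 0.
Proof. by rewrite mxE. Qed.

Lemma mx11Z (F : pzRingType) a (X : 'M[F]_1) : (a *: X) 0 0 = a * X 0 0.
Proof. by rewrite mxE. Qed.

Lemma mulmx_tr_rowE (F : comNzRingType) k (x y : 'rV[F]_k) :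
  (x *m y^T) 0 0 = \sum_i x 0 i * y 0 i.
Proof. by rewrite mxE; apply: eq_bigr => i _; rewrite mxE. Qed.

Lemma mulmx_tr_row_ge0 (F : realDomainType) k (x : 'rV[F]_k) :
  0 <= (x *m x^T) 0 0.
Proof. by rewrite mulmx_tr_rowE sumr_ge0 // => i _; rewrite -expr2 sqr_ge0. Qed.

Lemma mulmx_tr_row_eq0 (F : realDomainType) k (x : 'rV[F]_k) :
  ((x *m x^T) 0 0 == 0) = (x == 0).
Proof.
apply/eqP/eqP => [|->]; last by rewrite mul0mx mxE.
rewrite mulmx_tr_rowE => /psumr_eq0P H; apply/rowP => i; rewrite mxE.
have : x 0 i * x 0 i = 0 by apply: H => // j _; rewrite -expr2 sqr_ge0.
by move/eqP; rewrite mulf_eq0 orbb => /eqP.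
Qed.

Lemma mulmx_tr_eq0 (F : realDomainType) k l (A : 'M[F]_(k, l)) :
  A *m A^T = 0 -> A = 0.
Proof.
move=> H; apply/row_matrixP => i; rewrite row0; apply/eqP.
rewrite -mulmx_tr_row_eq0 tr_row -row_mul.
have -> : (row i (A *m col i A^T)) 0 0 = (A *m A^T) i i.
  by rewrite !mxE; apply: eq_bigr => j _; rewrite !mxE.
by rewrite H mxE.
Qed.

(** The discriminant argument behind the Cauchy-Schwarz inequality. *)
Lemma quadratic_ge0_linear_eq0 (F : realFieldType) (b c : F) :
  (forall l, 0 <= 2 * l * b + l ^+ 2 * c) -> b = 0.
Proof.
move=> H; have c0 : 0 <= c by have := H 1; have := H (-1); lra.
apply/eqP/negPn/negP => b0.
have b2 : 0 < b ^+ 2 by rewrite exprn_even_gt0.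
have c1 : c + 1 != 0 by apply: lt0r_neq0; lra.
have := H (- b / (c + 1)).
have -> : 2 * (- b / (c + 1)) * b + (- b / (c + 1)) ^+ 2 * c =
   - (b ^+ 2 * (c + 2)) / (c + 1) ^+ 2 by field.
have c2 : 0 < c + 2 by lra.
have c12 : 0 < (c + 1) ^+ 2 by rewrite exprn_even_gt0.
rewrite leNgt => /negP; apply; rewrite mulNr oppr_lt0.
by apply: divr_gt0 => //; apply: mulr_gt0.
Qed.

Lemma mulmx_trC (F : comNzRingType) k l (G : 'M[F]_(k,l)) (x : 'rV_k) (y : 'rV_l) :
  (x *m G *m y^T) 0 0 = (y *m G^T *m x^T) 0 0.
Proof.
transitivity ((y *m G^T *m x^T)^T 0 0); last by rewrite mxE.
by rewrite !trmx_mul !trmxK mulmxA.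
Qed.

Lemma psd_mx_isotropic (F : realFieldType) k (G : 'M[F]_k) (x : 'rV_k) :
  G^T = G -> psd_mx G -> (x *m G *m x^T) 0 0 = 0 -> x *m G = 0.
Proof.
move=> Gs Gp x0.
have xy (y : 'rV_k) : (x *m G *m y^T) 0 0 = 0.
  apply: (@quadratic_ge0_linear_eq0 _ _ ((y *m G *m y^T) 0 0)) => l.
  have := Gp (x + l *: y).
  have -> : ((x + l *: y) *m G *m (x + l *: y)^T) 0 0 =
    (x *m G *m x^T) 0 0 + l * (x *m G *m y^T) 0 0 + l * (y *m G *m x^T) 0 0 +
    l * l * (y *m G *m y^T) 0 0.
    rewrite linearD /= linearZ /= !(mulmxDl, mulmxDr) -?(scalemxAl, scalemxAr).
    rewrite -?(scalemxAl, scalemxAr) !(mx11D, mx11Z); ring.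
  rewrite x0 (mulmx_trC G y x) Gs.
  congr (0 <= _); ring.
apply/rowP => i; have := xy (delta_mx 0 i).
by rewrite trmx_delta -colE mxE => ->; rewrite mxE.
Qed.

Lemma psd_unitmx_posdef (F : realFieldType) k (G : 'M[F]_k) :
  G^T = G -> psd_mx G -> G \in unitmx -> posdef_mx G.
Proof.
move=> Gs Gp Gu x x0; rewrite lt_neqAle Gp andbT eq_sym.
apply/negP => /eqP /(psd_mx_isotropic Gs Gp) xG; case/negP: x0.
by rewrite -(mulmxK Gu x) xG mul0mx.
Qed.

Lemma symmetric_borderE (F : nzRingType) k (G : 'M[F]_(1 + k)) : G^T = G ->
  G = block_mx (G 0 0)%:M (ursubmx G) (ursubmx G)^T (drsubmx G) /\
  (drsubmx G)^T = drsubmx G.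
Proof.
move=> Gs; split; last by rewrite trmx_drsub Gs.
rewrite -[LHS](@submxK _ 1 k 1 k); congr block_mx; last by rewrite trmx_ursub Gs.
by rewrite [LHS]mx11_scalar !mxE; congr (G _ _)%:M; apply: val_inj.
Qed.

(** Induction on the Schur complement of the upper left entry. *)
Lemma cholesky (F : rcfType) k (G : 'M[F]_k) :
  G^T = G -> posdef_mx G -> exists2 C : 'M_k, C \in unitmx & G = C *m C^T.
Proof.
elim: k G => [|k IH] G Gs Gp.
  by exists 1%:M; rewrite ?unitmx1 //; apply/matrixP => - [].
have [GE Ds] := @symmetric_borderE _ k G Gs.
move: Ds GE; set a := G 0 0; set b := ursubmx _; set D := drsubmx _ => Ds GE.
have {}Gp : @posdef_mx F (1 + k) (block_mx a%:M b b^T D) by rewrite -GE.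
have a0 : 0 < a.
  have := Gp (row_mx 1 0 : 'rV_(1 + k)).
  rewrite tr_row_mx mul_row_block mul_row_col !mul1mx !mul0mx trmx0 !mulmx0.
  rewrite trmx1 mulmx1 !addr0 mxE mulr1n; apply; apply/eqP => /rowP /(_ 0).
  have -> : (0 : 'I_(1 + k)) = lshift k 0 by apply: val_inj.
  by rewrite row_mxEl !mxE eqxx; apply/eqP; rewrite oner_eq0.
pose D' := D - a^-1 *: (b^T *m b).
have D's : D'^T = D' by rewrite /D' linearB linearZ /= trmx_mul trmxK Ds.
have D'p : posdef_mx D'.
  move=> y y0; have := Gp (row_mx (- a^-1 *: (y *m b^T)) y : 'rV_(1 + k)).
  rewrite tr_row_mx mul_row_block mul_row_col.
  rewrite mul_mx_scalar scalerA mulrN divff ?lt0r_neq0 // scaleN1r addNr mul0mx add0r.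
  suff -> : - a^-1 *: (y *m b^T) *m b + y *m D = y *m D'.
    apply; apply: contraNneq y0 => /(congr1 rsubmx).
    by rewrite row_mxKr => ->; apply/eqP/rowP => i; rewrite !mxE.
  by rewrite /D' mulmxBr -scalemxAr -scalemxAl mulmxA scaleNr addrC.
have [C' C'u C'E] := IH D' D's D'p.
have s0 : Num.sqrt a != 0 by rewrite sqrtr_eq0 -ltNge.
suff [C Cu CE] : exists2 C : 'M_(1 + k), C \in unitmx &
    block_mx a%:M b b^T D = C *m C^T by exists C; rewrite ?GE.
exists (block_mx (Num.sqrt a)%:M 0 ((Num.sqrt a)^-1 *: b^T) C').
  rewrite unitmxE det_lblock det_scalar1 unitrM -unitmxE C'u andbT.
  by rewrite unitfE.
rewrite tr_block_mx mulmx_block trmx0 !mul0mx !mulmx0 !addr0.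
rewrite tr_scalar_mx -scalar_mxM -expr2 sqr_sqrtr ?ltW //.
rewrite [(_ *: b^T)^T]linearZ /= trmxK mul_scalar_mx scalerA divff // scale1r.
rewrite mul_mx_scalar scalerA divff // scale1r -C'E.
rewrite -scalemxAl -scalemxAr scalerA.
by rewrite -invfM -expr2 sqr_sqrtr ?ltW // /D' addrC subrK.
Qed.

Definition gram (W : Type) (F : Type) (G : W -> W -> F) k (s : 'I_k -> W) : 'M_k :=
  \matrix_(i, j) G (s i) (s j).

Definition fam_rcons (W : Type) k (s : 'I_k -> W) (v : W) (i : 'I_(k + 1)) : W :=
  if split i is inl a then s a else v.

Lemma gram_rcons (W F : Type) (G : W -> W -> F) k (s : 'I_k -> W) (v : W) :
  gram G (fam_rcons s v) =
  block_mx (gram G s) (\col_i G (s i) v) (\row_i G v (s i)) (\matrix_(i, j) G v v).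
Proof.
apply/matrixP => i j; rewrite /block_mx /gram !mxE /fam_rcons.
by case: (split i) => a; rewrite ?mxE; case: (split j) => b; rewrite ?mxE.
Qed.

(** Orthonormal coordinates for a positive semidefinite form of bounded rank
    on a mere set. A family s whose Gram matrix is invertible and of maximal
    size determines the form: adding any u makes the Gram matrix singular,
    which exhibits u, up to an isotropic vector, as a combination of s. A
    Cholesky factor of the Gram matrix of s then orthonormalizes. *)
Theorem gram_realization (F : rcfType) (W : Type) (G : W -> W -> F) (M : nat) :
  (forall u v, G u v = G v u) ->
  (forall k (s : 'I_k -> W), psd_mx (gram G s)) ->
  (forall k (s : 'I_k -> W), (M < k)%N -> \det (gram G s) = 0) ->
  exists m (s : 'I_m -> W) (c : W -> 'cV[F]_m),
    (forall u v, (c u)^T *m c v = (G u v)%:M) /\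
    (\matrix_(i, j) c (s j) i 0) \in unitmx.
Proof.
move=> Gs Gp Gb.
have gs k (s : 'I_k -> W) : (gram G s)^T = gram G s.
  by apply/matrixP => i j; rewrite !mxE.
pose P k := `[< exists s : 'I_k -> W, \det (gram G s) != 0 >].
have exP : exists k, P k.
  exists 0%N; apply/asboolP; 
  exists (fun i : 'I_0 => match i with Ordinal _ h => match notF h with end end).
  by rewrite det_mx00 oner_neq0.
have bP k : P k -> (k <= M)%N.
  move=> /asboolP [s]; apply: contraNT; rewrite -ltnNge => /Gb ->.
  exact: eqxx.
case: (ex_maxnP exP bP) => m /asboolP [s sdet] mmax.
have su : gram G s \in unitmx by rewrite unitmxE unitfE.
have [C Cu CE] := cholesky (gs _ s) (psd_unitmx_posdef (gs _ s) (Gp _ s) su).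
pose g v : 'cV_m := \col_i G (s i) v.
exists m, s, (fun v => invmx C *m g v); split; last first.
  suff -> : (\matrix_(i, j) (invmx C *m g (s j)) i 0) = C^T by rewrite unitmx_tr.
  have -> : C^T = invmx C *m gram G s by rewrite CE mulKmx.
  by apply/matrixP => i j; rewrite !mxE; apply: eq_bigr => k _; rewrite !mxE.
move=> u v.
have -> : (invmx C *m g u)^T *m (invmx C *m g v) =
  (g u)^T *m invmx (gram G s) *m g v.
  rewrite trmx_mul !mulmxA; congr (_ *m _); rewrite -!mulmxA; congr (_ *m _).
  rewrite trmx_inv; apply: (can_inj (mulmxK su)); rewrite mulVmx // CE mulmxA.
  by rewrite -(mulmxA _ (invmx C)) mulVmx // mulmx1 mulVmx // unitmx_tr.
(* maximality: u is, up to an isotropic vector, a combination of the s i *)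
have : \det (gram G (fam_rcons s u)) == 0.
  apply/negPn/negP => H.
  have /mmax : P (m + 1)%N by apply/asboolP; exists (fam_rcons s u).
  by rewrite addn1 ltnn.
case/det0P => y y0 yG.
have yv w : (lsubmx y *m g w) 0 0 + y 0 (rshift m 0) * G u w = 0.
  apply: (@quadratic_ge0_linear_eq0 _ _ (G w w)) => l.
  have := Gp _ (fam_rcons (fam_rcons s u) w) (row_mx y l%:M).
  rewrite gram_rcons mul_row_block tr_row_mx mul_row_col yG add0r.
  set A := \col_i _; set B := \row_i _; set D := \matrix_(i, j) _.
  have yA : (y *m A) 0 0 = (lsubmx y *m g w) 0 0 + y 0 (rshift m 0) * G u w.
    rewrite !mxE big_split_ord /= big_ord1 !mxE /fam_rcons (unsplitK (inr _)).
    by congr (_ + _); apply: eq_bigr => i _; rewrite !mxE /fam_rcons (unsplitK (inl _)).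
  have BA : B *m y^T = (y *m A)^T.
    by rewrite trmx_mul; congr (_ *m _); apply/rowP => i; rewrite !mxE Gs.
  rewrite mulmxDl -mulmxA BA tr_scalar_mx !mul_mx_scalar mul_scalar_mx.
  have trE (X : 'M[F]_1) : X^T 0 0 = X 0 0 by rewrite mxE.
  have DE : D 0 0 = G w w by rewrite mxE.
  rewrite !(mx11D, mx11Z) mul_scalar_mx mx11Z trE yA DE.
  congr (_ <= _); ring.
set y1 := y 0 (rshift m 0) in yv; set y2 := lsubmx y in yv.
have y2E : y2 *m gram G s = - y1 *: (g u)^T.
  apply/rowP => i; have := yv (s i); move/eqP; rewrite addr_eq0 => /eqP.
  rewrite !mxE mulNr (Gs u) => <-.
  by apply: eq_bigr => k _; rewrite !mxE.
have y10 : y1 != 0.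
  apply: contraNneq y0 => y10; rewrite y10 oppr0 scale0r in y2E.
  have y20 : y2 = 0 by rewrite -(mulmxK su y2) y2E mul0mx.
  apply/eqP/rowP => i; rewrite mxE -(splitK i); case: (split i) => j /=.
    by have /rowP/(_ j) := y20; rewrite !mxE.
  by rewrite ord1.
have -> : (g u)^T *m invmx (gram G s) = - y1^-1 *: y2.
  apply: (canLR (mulmxK su)); rewrite -scalemxAl y2E scalerA mulrNN mulVf //.
  by rewrite scale1r.
rewrite -scalemxAl [LHS]mx11_scalar; congr (_%:M); rewrite mxE.
have := yv v; move/eqP; rewrite addr_eq0 => /eqP ->.
by rewrite mulrNN mulKf.
Qed.

(** * Positivity over a subring *)

Lemma bordered_formE (F : comNzRingType) k (a : F) (b : 'rV[F]_k) (D : 'M[F]_k) s y :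
  (row_mx s%:M y *m block_mx a%:M b b^T D *m (row_mx s%:M y)^T) 0 0 =
  a * s ^+ 2 + 2 * s * (b *m y^T) 0 0 + (y *m D *m y^T) 0 0.
Proof.
rewrite tr_row_mx mul_row_block mul_row_col !mulmxDl tr_scalar_mx.
have by_ : (y *m b^T) 0 0 = (b *m y^T) 0 0.
  by rewrite !mulmx_tr_rowE; apply: eq_bigr => i _; rewrite mulrC.
rewrite -scalar_mxM mul_mx_scalar mul_scalar_mx -scalemxAl mul_mx_scalar.
by rewrite !(mx11D, mx11Z) by_ [_%:M _ _]mxE eqxx mulr1n; ring.
Qed.

(** Clearing denominators in the Schur complement, positivity on vectors with
    entries in a subring A of the scalars propagates to all vectors. Density
    of A is not available: A may lie in a non-archimedean field and be
    bounded. *)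
Lemma psd_mx_subring (F : realFieldType) (A : F -> Prop) k (G : 'M[F]_k) :
  A 1 -> (forall x y, A x -> A y -> A (x - y)) ->
  (forall x y, A x -> A y -> A (x * y)) ->
  G^T = G -> (forall i j, A (G i j)) ->
  (forall x : 'rV_k, (forall i, A (x 0 i)) -> 0 <= (x *m G *m x^T) 0 0) ->
  psd_mx G.
Proof.
move=> A1 AB AM; have A0 : A 0 by rewrite -(subrr 1); apply: (AB _ _).
have AN x : A x -> A (- x) by move=> Ax; rewrite -sub0r; apply: (AB _ _).
have AD x y : A x -> A y -> A (x + y) by move=> Ax Ay; rewrite -[y]opprK; apply/AB/AN.
have Asum (I : finType) (f : I -> F) : (forall i, A (f i)) -> A (\sum_i f i).
  by move=> Af; apply: big_ind.
elim: k G => [|k IH] G Gs GA Gp.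
  by move=> x; rewrite mxE big_ord0.
have [GE Ds] := @symmetric_borderE _ k G Gs.
move: Ds GE; set a := G 0 0; set b := ursubmx _; set D := drsubmx _ => Ds GE.
have aA : A a by exact: GA.
have bA j : A (b 0 j) by rewrite !mxE; exact: GA.
have DA i j : A (D i j) by rewrite !mxE; exact: GA.
have Gp' s (y : 'rV[F]_k) : A s -> (forall i, A (y 0 i)) ->
    0 <= a * s ^+ 2 + 2 * s * (b *m y^T) 0 0 + (y *m D *m y^T) 0 0.
  move=> As Ay; rewrite -bordered_formE -GE; apply: (Gp (row_mx s%:M y : 'rV_(1 + k))).
  move=> i; rewrite -(@splitK 1 k i); case: (split _) => j /=.
    by rewrite (@row_mxEl _ 1 1 k) mxE ord1 eqxx.
  by rewrite (@row_mxEr _ 1 1 k).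
suff H : forall s (y : 'rV[F]_k),
    0 <= a * s ^+ 2 + 2 * s * (b *m y^T) 0 0 + (y *m D *m y^T) 0 0.
  move=> x; rewrite GE -[x](@hsubmxK _ 1 1 k) [lsubmx _]mx11_scalar bordered_formE.
  exact: H.
have formA (y : 'rV[F]_k) (E : 'M[F]_k) : (forall i, A (y 0 i)) ->
    (forall i j, A (E i j)) -> A ((y *m E *m y^T) 0 0).
  move=> Ay AE; rewrite mxE; apply: (Asum _ _) => i; rewrite [y^T _ _]mxE.
  by apply: (AM _ _) => //; rewrite mxE; apply: (Asum _ _) => j; apply: (AM _ _).
have byA (y : 'rV[F]_k) : (forall i, A (y 0 i)) -> A ((b *m y^T) 0 0).
  by move=> Ay; rewrite mulmx_tr_rowE; apply: (Asum _ _) => i; apply: (AM _ _).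
have AZ c (y : 'rV[F]_k) : A c -> (forall i, A (y 0 i)) -> forall i, A ((c *: y) 0 i).
  by move=> Ac Ay i; rewrite mxE; apply: (AM _ _).
have form_scale c (y : 'rV[F]_k) :
    ((c *: y) *m D *m (c *: y)^T) 0 0 = c ^+ 2 * (y *m D *m y^T) 0 0.
  rewrite [(c *: y)^T]linearZ /= -scalemxAr -!scalemxAl scalerA mxE expr2 //.
have lin_scale c (y : 'rV[F]_k) : (b *m (c *: y)^T) 0 0 = c * (b *m y^T) 0 0.
  by rewrite [(c *: y)^T]linearZ /= -scalemxAr mxE.
have a0 : 0 <= a.
  have := Gp' 1 0 A1; rewrite trmx0 !mulmx0 mxE expr1n mulr1 mulr0 !addr0; apply.
  by move=> i; rewrite mxE.
move: a0; rewrite le_eqVlt => /orP [/eqP a0|a0].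
  have D_psd : psd_mx D.
    apply: IH => // y Ay; have := Gp' 0 y A0 Ay.
    by rewrite expr0n mulr0 mulr0 mul0r add0r add0r.
  have b0 (y : 'rV[F]_k) : (forall i, A (y 0 i)) -> (b *m y^T) 0 0 = 0.
    move=> Ay; set be := (b *m y^T) 0 0; pose de := (y *m D *m y^T) 0 0.
    have bey (s : F) : A s -> 0 <= 2 * s * be ^+ 2 + be ^+ 2 * de.
      move=> As; have := Gp' s (be *: y) As (AZ _ _ (byA _ Ay) Ay).
      rewrite form_scale lin_scale -a0 -/be -/de mul0r add0r => H.
      by apply: le_trans H _; rewrite le_eqVlt; apply/orP; left; apply/eqP; ring.
    (* s = - de gives de = 0, and then s = -1 gives be = 0 *)
    apply/eqP/negPn/negP => be0; have be2 : 0 < be ^+ 2 by rewrite exprn_even_gt0.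
    have de0 : 0 <= de by exact: D_psd.
    have := bey (- de) (AN _ (formA _ _ Ay DA)); have := bey (- 1) (AN _ A1).
    by nra.
  have b00 : b = 0.
    apply/rowP => j; rewrite [RHS]mxE -(b0 (delta_mx 0 j)).
      by rewrite trmx_delta -colE [RHS]mxE.
    by move=> i; rewrite mxE; case: (_ && _); [exact: A1|exact: A0].
  by move=> s y; rewrite -a0 b00 mul0mx mul0r mxE mulr0 !add0r; exact: D_psd.
pose D' := a *: D - b^T *m b.
have D'E (y : 'rV[F]_k) : (y *m D' *m y^T) 0 0 =
    a * (y *m D *m y^T) 0 0 - (b *m y^T) 0 0 ^+ 2.
  have -> : y *m D' *m y^T = a *: (y *m D *m y^T) - (b *m y^T)^T *m (b *m y^T).
    by rewrite /D' mulmxBr mulmxBl -scalemxAr -scalemxAl trmx_mul trmxK !mulmxA.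
  have subE (X Y : 'M[F]_1) : (a *: X - Y^T *m Y) 0 0 = a * X 0 0 - Y 0 0 ^+ 2.
    by rewrite !mxE big_ord1 mxE expr2.
  exact: subE.
have D'_psd : psd_mx D'.
  apply: IH.
  - by rewrite /D' linearB linearZ /= trmx_mul trmxK Ds.
  - move=> i j.
    have -> : D' i j = a * D i j - \sum_t b t i * b t j.
      have -> (X Y : 'M[F]_k) : (a *: X - Y) i j = a * X i j - Y i j by rewrite !mxE.
      by congr (_ - _); rewrite mxE; apply: eq_bigr => t _; rewrite mxE.
    apply: (AB _ _); first exact: (AM _ _ aA (DA i j)).
    by apply: (Asum _ _) => t; rewrite ord1; exact: (AM _ _ (bA i) (bA j)).
  move=> y Ay; rewrite D'E.
  have := Gp' (- (b *m y^T) 0 0) (a *: y) (AN _ (byA _ Ay)) (AZ _ _ aA Ay).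
  rewrite form_scale lin_scale => H; rewrite -(pmulr_rge0 _ a0).
  by apply: le_trans H _; rewrite le_eqVlt; apply/orP; left; apply/eqP; ring.
move=> s y; have := D'_psd y; rewrite D'E.
set be := (b *m y^T) 0 0; set de := (y *m D *m y^T) 0 0 => H.
rewrite -(pmulr_rge0 _ a0).
have := sqr_ge0 (a * s + be); by nra.
Qed.

(** * Projections in the commutant of a self-adjoint family *)

Lemma mxtrace_idem (F : fieldType) k (E : 'M[F]_k) :
  E *m E = E -> \tr E = (\rank E)%:R.
Proof.
move=> EE; rewrite -{1}(mulmx_base E) mxtrace_mulC.
suff -> : row_base E *m col_base E = 1%:M by rewrite mxtrace1.
have : col_base E *m row_base E *m (col_base E *m row_base E) =
  col_base E *m row_base E by rewrite mulmx_base.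
move: (col_base E) (row_base E) (col_base_full E) (row_base_free E).
move: (\rank E) => r C R Cf Rf CR.
apply: (row_free_inj Rf); rewrite mul1mx; apply: (row_full_inj Cf).
by rewrite -CR !mulmxA.
Qed.

(** With an eigenvector u1 + i u2 for a complex eigenvalue a + i b, comparing
    u1 A u2^t with its transpose gives b (|u1|^2 + |u2|^2) = 0. *)
Lemma symmetric_eigenvalue (F : rcfType) k (A : 'M[F]_k) :
  (0 < k)%N -> A^T = A -> exists (a : F) (u : 'rV_k), u != 0 /\ u *m A = a *: u.
Proof.
move=> k0 As; pose f := real_complex F; pose AC := map_mx f A.
have /closed_rootP [z] : size (char_poly AC) != 1.
  by rewrite size_char_poly; case: (k) k0.
rewrite -eigenvalue_root_char => /eigenvalueP [u uA u0].
pose u1 := map_mx (@complex.Re F) u; pose u2 := map_mx (@complex.Im F) u.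
pose a := complex.Re z; pose b := complex.Im z.
have ReD : {morph @complex.Re F : x y / x + y} by move=> [? ?] [? ?].
have ImD : {morph @complex.Im F : x y / x + y} by move=> [? ?] [? ?].
have uA1 : u1 *m A = a *: u1 - b *: u2.
  apply/rowP => j; have /rowP/(_ j)/(congr1 (@complex.Re F)) := uA.
  rewrite !mxE (big_morph _ ReD (erefl : complex.Re 0 = 0)) => E.
  transitivity (complex.Re (z * u 0 j)).
    rewrite -E; apply: eq_bigr => i _; rewrite !mxE.
    by case: (u 0 i) => p q /=; rewrite mulr0 subr0.
  by rewrite /a /b; case: (z) => ? ?; case: (u 0 j).
have uA2 : u2 *m A = b *: u1 + a *: u2.
  apply/rowP => j; have /rowP/(_ j)/(congr1 (@complex.Im F)) := uA.
  rewrite !mxE (big_morph _ ImD (erefl : complex.Im 0 = 0)) => E.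
  transitivity (complex.Im (z * u 0 j)).
    rewrite -E; apply: eq_bigr => i _; rewrite !mxE.
    by case: (u 0 i) => p q /=; rewrite mulr0 add0r.
  by rewrite /a /b; case: (z) => ? ?; case: (u 0 j) => ? ? /=; rewrite addrC.
have u12 : (u1 != 0) || (u2 != 0).
  rewrite -negb_and; apply: contra u0 => /andP [/eqP u10 /eqP u20].
  apply/eqP/rowP => j; have /rowP/(_ j) := u10; have /rowP/(_ j) := u20.
  by rewrite !mxE; case: (u 0 j) => p q /= -> ->.
have b0 : b = 0.
  have := mulmx_trC A u1 u2.
  rewrite As uA1 uA2 !mulmxDl mulNmx -!scalemxAl.
  have oppE (X : 'M[F]_1) : (- X) 0 0 = - X 0 0 by rewrite mxE.
  have sym : (u2 *m u1^T) 0 0 = (u1 *m u2^T) 0 0.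
    by rewrite !mulmx_tr_rowE; apply: eq_bigr => i _; rewrite mulrC.
  rewrite !(mx11D, oppE, mx11Z) sym => E.
  have {}E : b * ((u1 *m u1^T) 0 0 + (u2 *m u2^T) 0 0) = 0.
    by move/eqP: E; rewrite -subr_eq0 => /eqP E; rewrite -[RHS]oppr0 -E; ring.
  move/eqP: E; rewrite mulf_eq0 => /orP [/eqP //|].
  rewrite paddr_eq0 ?mulmx_tr_row_ge0 // !mulmx_tr_row_eq0.
  by rewrite -[_ && _]negbK negb_and u12.
rewrite b0 !scale0r subr0 add0r in uA1 uA2.
by case/orP: u12 => u0'; [exists a, u1 | exists a, u2].
Qed.

Lemma orthonormal_rows (F : rcfType) p m (A : 'M[F]_(p, m)) :
  exists2 Q : 'M_(\rank A, m), Q *m Q^T = 1%:M & (Q :=: A)%MS.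
Proof.
have [B Bf BA] : exists2 B : 'M_(\rank A, m), row_free B & (B :=: A)%MS.
  by exists (row_base A); [exact: row_base_free | exact: eq_row_base].
have Bp : posdef_mx (B *m B^T).
  move=> x x0.
  have -> : x *m (B *m B^T) *m x^T = x *m B *m (x *m B)^T by rewrite trmx_mul !mulmxA.
  rewrite lt_neqAle mulmx_tr_row_ge0 andbT.
  by rewrite eq_sym mulmx_tr_row_eq0 mulmx_free_eq0.
have Bs : (B *m B^T)^T = B *m B^T by rewrite trmx_mul trmxK.
have [C Cu CE] := cholesky Bs Bp.
have CTu : C^T \in unitmx by rewrite unitmx_tr.
exists (invmx C *m B); last first.
  by apply: eqmx_trans (eqmxMfull _ _) BA; rewrite row_full_unit unitmx_inv.
by rewrite trmx_mul mulmxA -(mulmxA _ B) CE trmx_inv mulmxA mulVmx // mul1mx mulmxV.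
Qed.

Definition is_proj (F : rcfType) m (P : 'M[F]_m) := P^T = P /\ P *m P = P.

Section CommutantAlgebra.
Variables (F : rcfType) (m : nat) (I : Type) (L : I -> 'M[F]_m) (inv : I -> I).
Hypothesis Linv : forall i, L (inv i) = (L i)^T.

Definition commutant (T : 'M[F]_m) := forall i, L i *m T = T *m L i.

Lemma commutantM A B : commutant A -> commutant B -> commutant (A *m B).
Proof. by move=> hA hB i; rewrite mulmxA hA -mulmxA hB mulmxA. Qed.

Lemma commutantD A B : commutant A -> commutant B -> commutant (A + B).
Proof. by move=> hA hB i; rewrite mulmxDr mulmxDl hA hB. Qed.

Lemma commutantZ a A : commutant A -> commutant (a *: A).
Proof. by move=> hA i; rewrite -scalemxAr -scalemxAl hA. Qed.

Lemma commutantB A B : commutant A -> commutant B -> commutant (A - B).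
Proof. by move=> hA hB i; rewrite mulmxBr mulmxBl hA hB. Qed.

Lemma commutant1 : commutant 1%:M.
Proof. by move=> i; rewrite mulmx1 mul1mx. Qed.

Lemma commutant0 : commutant 0.
Proof. by move=> i; rewrite mulmx0 mul0mx. Qed.

Lemma commutantT A : commutant A -> commutant A^T.
Proof.
move=> hA i; have := congr1 trmx (hA (inv i)).
by rewrite !trmx_mul Linv trmxK.
Qed.

(** The kernel of X is stable under the self-adjoint family L, hence so is its
    orthogonal complement; the projection therefore commutes with L. *)
Lemma commutant_ker_proj X : commutant X ->
  exists Q, [/\ is_proj Q, commutant Q, X *m Q = 0 &
    forall k (v : 'M_(m, k)), X *m v = 0 -> Q *m v = v].
Proof.
move=> hX; have [Q QQ QK] := orthonormal_rows (kermx X^T).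
have Qv k (v : 'M_(m, k)) : X *m v = 0 -> Q^T *m Q *m v = v.
  move=> Xv; have /submxP [D vD] : (v^T <= Q)%MS.
    by rewrite QK; apply/sub_kermxP; rewrite -trmx_mul Xv trmx0.
  apply: trmx_inj; rewrite trmx_mul vD trmx_mul trmxK -!mulmxA.
  by rewrite (mulmxA Q) QQ mul1mx.
have XQ : X *m Q^T = 0.
  apply: trmx_inj; rewrite trmx_mul trmxK trmx0; apply/sub_kermxP.
  by rewrite QK.
have LQ i : Q^T *m Q *m (L i *m (Q^T *m Q)) = L i *m (Q^T *m Q).
  by apply: Qv; rewrite mulmxA -hX -mulmxA (mulmxA X) XQ mul0mx mulmx0.
exists (Q^T *m Q); split=> //.
- by split; rewrite ?trmx_mul ?trmxK // -!mulmxA (mulmxA Q) QQ mul1mx.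
- move=> i; rewrite -LQ; have := congr1 trmx (LQ (inv i)).
  by rewrite Linv !trmx_mul !trmxK -!mulmxA => ->.
- by rewrite mulmxA XQ mul0mx.
Qed.

Definition minimal_proj (P : 'M[F]_m) := [/\ is_proj P, commutant P, P != 0 &
  forall Q, is_proj Q -> commutant Q -> P *m Q = Q -> Q = 0 \/ Q = P].

Lemma mxrank_proj_eq0 (P : 'M[F]_m) : (0 < \rank P)%N = (P != 0).
Proof. by rewrite lt0n mxrank_eq0. Qed.

Lemma is_projB (P Q : 'M[F]_m) : 
  is_proj P -> is_proj Q -> P *m Q = Q -> is_proj (P - Q).
Proof.
move=> [Ps PP] [Qs QQ] PQ.
have QP : Q *m P = Q by apply: trmx_inj; rewrite trmx_mul Ps Qs.
split; first by rewrite linearB /= Ps Qs.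
by rewrite mulmxBl !mulmxBr PP PQ QP QQ subrr subr0.
Qed.

Lemma minimal_decomposition P : is_proj P -> commutant P ->
  exists Ps : seq 'M_m, (forall Q, Q \in Ps -> minimal_proj Q) /\
    \sum_(Q <- Ps) Q = P.
Proof.
have [n] := ubnP (\rank P); elim: n P => // n IH P; rewrite ltnS => rP pP cP.
have [->|P0] := eqVneq P 0; first by exists [::]; rewrite big_nil.
have [minP|] := pselect (minimal_proj P).
  by exists [:: P]; rewrite big_seq1; split=> // Q; rewrite inE => /eqP ->.
move=> nmin.
have [Q [pQ cQ PQ Q0 QP]] : exists Q, [/\ is_proj Q, commutant Q, P *m Q = Q,
    Q != 0 & Q != P].
  apply: contrapT => H; apply: nmin; split=> // Q pQ cQ PQ.
  have [->|Q0] := eqVneq Q 0; first by left.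
  have [->|QP] := eqVneq Q P; first by right.
  by case: H; exists Q.
have pD := is_projB pP pQ PQ.
have rE : (\rank P = \rank Q + \rank (P - Q)%R)%N.
  apply/eqP; rewrite -(eqr_nat F) natrD -!mxtrace_idem;
    try by case: pD pQ pP => ? ? [? ?] [? ?].
  by rewrite linearB /= addrC subrK.
have r1 : (0 < \rank Q)%N by rewrite mxrank_proj_eq0.
have r2 : (0 < \rank (P - Q)%R)%N by rewrite mxrank_proj_eq0 subr_eq0 eq_sym.
have [|Ps [mPs sPs]] := IH Q _ pQ cQ.
  by apply: leq_trans rP; rewrite rE -addn1 leq_add2l.
have [|Ps' [mPs' sPs']] := IH (P - Q) _ pD (commutantB cP cQ).
  by apply: leq_trans rP; rewrite rE -add1n leq_add2r.
exists (Ps ++ Ps'); rewrite big_cat /= sPs sPs' addrC subrK; split=> // A.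
by rewrite mem_cat => /orP [/mPs|/mPs'].
Qed.

(** The spectral theorem inside a corner: the eigenprojection of x for an
    eigenvalue on the image of P belongs to the commutant, so minimality makes
    it all of P. *)
Lemma minimal_sym_scalar P x : minimal_proj P -> commutant x ->
  P *m x = x -> x *m P = x -> x^T = x -> exists a, x = a *: P.
Proof.
move=> [[Ps PP] cP P0 minP] cx Px xP xs.
have [Q QQ QK] := orthonormal_rows P.
have QP : Q *m P = Q.
  have /submxP [D ->] : (Q <= P)%MS by rewrite QK.
  by rewrite -mulmxA PP.
have [||a [u [u0 uE]]] := @symmetric_eigenvalue _ _ (Q *m x *m Q^T).
- by rewrite mxrank_proj_eq0.
- by rewrite !trmx_mul trmxK xs mulmxA.
(* the summand 1 - P confines the kernel to the image of P *)
exists a; pose X := x - a *: P + (1%:M - P).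
have cX : commutant X.
  apply: commutantD; apply: commutantB => //; [exact: commutantZ|exact: commutant1].
have PX : P *m X = x - a *: P.
  by rewrite mulmxDr !mulmxBr mulmx1 PP subrr addr0 Px -scalemxAr PP.
have [R [pR cR XR Rv]] := commutant_ker_proj cX.
have PR : (x - a *: P) *m R = 0 by rewrite -PX -mulmxA XR mulmx0.
have PR' : P *m R = R.
  move: XR; rewrite mulmxDl PR add0r mulmxBl mul1mx => /eqP.
  by rewrite subr_eq0 => /eqP.
have [R0|RP] := minP R pR cR PR'.
  case/eqP: u0; have : R *m (u *m Q)^T = (u *m Q)^T.
    apply: Rv; apply: trmx_inj; rewrite trmx_mul trmxK trmx0.
    have Xs : X^T = X by rewrite /X !(linearD, linearN, linearZ) /= Ps xs trmx1.
    have E : u *m Q *m x = a *: (u *m Q).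
      have /submxP [D' DE'] : (u *m Q *m x <= Q)%MS.
        by rewrite QK; apply/submxP; exists (u *m Q *m x); rewrite -(mulmxA _ x P) xP.
      rewrite scalemxAl -uE !mulmxA DE' -!mulmxA (mulmxA Q Q^T) QQ mul1mx.
      by [].
    have QPu : u *m Q *m P = u *m Q by rewrite -mulmxA QP.
    by rewrite Xs /X mulmxDr !mulmxBr mulmx1 -scalemxAr QPu E !subrr addr0.
  rewrite R0 mul0mx => /(congr1 trmx); rewrite trmx0 trmxK => uQ.
  by rewrite -(mulmx1 u) -QQ mulmxA -uQ mul0mx.
by move/eqP: PR; rewrite RP mulmxBl xP -scalemxAl PP subr_eq0 => /eqP.
Qed.
End CommutantAlgebra.

(** * Tracial vector states on a commutant *)

Definition word_prod (A : nzRingType) (I : Type) k (Y : I -> 'M[A]_k) (v : seq I) :=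
  \big[mulmx/1%:M]_(i <- v) Y i.

Lemma word_prod_cat (A : nzRingType) I k (Y : I -> 'M[A]_k) (u v : seq I) :
  word_prod Y (u ++ v) = word_prod Y u *m word_prod Y v.
Proof.
rewrite /word_prod; elim: u => [|i u IH]; first by rewrite big_nil mul1mx.
by rewrite cat_cons !big_cons IH mulmxA.
Qed.

Lemma word_prod_cons (A : nzRingType) I k (Y : I -> 'M[A]_k) i (v : seq I) :
  word_prod Y (i :: v) = Y i *m word_prod Y v.
Proof. exact: big_cons. Qed.

Lemma word_prod_nil (A : nzRingType) I k (Y : I -> 'M[A]_k) :
  word_prod Y [::] = 1%:M.
Proof. exact: big_nil. Qed.

Section VectorState.
Variables (A : comNzRingType) (m : nat) (w : 'cV[A]_m).

Definition vstate (T : 'M[A]_m) : A := (w^T *m T *m w) 0 0.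

Lemma vstateD S T : vstate (S + T) = vstate S + vstate T.
Proof. by rewrite /vstate mulmxDr mulmxDl mxE. Qed.

Lemma vstateZ a T : vstate (a *: T) = a * vstate T.
Proof. by rewrite /vstate -scalemxAr -scalemxAl mxE. Qed.

Lemma vstateN T : vstate (- T) = - vstate T.
Proof. by rewrite -scaleN1r vstateZ mulN1r. Qed.

Lemma vstate0 : vstate 0 = 0.
Proof. by rewrite -(scale0r 0) vstateZ mul0r. Qed.

Lemma vstate_sum (J : Type) (r : seq J) (p : pred J) (f : J -> 'M_m) :
  vstate (\sum_(j <- r | p j) f j) = \sum_(j <- r | p j) vstate (f j).
Proof. exact: (big_morph _ vstateD vstate0). Qed.

Lemma vstateT (T : 'M[A]_m) : vstate T^T = vstate T.
Proof.
rewrite /vstate; transitivity ((w^T *m T *m w)^T 0 0); last by rewrite mxE.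
by rewrite !trmx_mul trmxK mulmxA.
Qed.
End VectorState.

Section TracialCommutant.
Variables (F : rcfType) (m : nat) (I : Type) (L : I -> 'M[F]_m) (inv : I -> I).
Hypothesis Linv : forall i, L (inv i) = (L i)^T.
Variable w : 'cV[F]_m.
Local Notation N := (commutant L).
Local Notation minimal := (minimal_proj L).

Local Notation tau := (vstate w).

Hypothesis tauC : forall A B, N A -> N B -> tau (A *m B) = tau (B *m A).
Hypothesis cyclic_w : forall v : 'cV[F]_m, exists2 A, N A & A *m w = v.

Lemma vstate_norm (A : 'M[F]_m) : tau (A^T *m A) = ((A *m w)^T *m ((A *m w)^T)^T) 0 0.
Proof. by rewrite trmxK trmx_mul /vstate !mulmxA. Qed.

(** A vector that is cyclic for the commutant is separating as well, because
    the state is a trace. *)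
Lemma separating_vector T : N T -> T *m w = 0 -> T = 0.
Proof.
move=> cT Tw; apply: trmx_inj; apply/row_matrixP => j; rewrite trmx0 row0.
have [A cA AE] := cyclic_w (delta_mx j 0).
rewrite -tr_col colE -AE mulmxA; apply/eqP.
rewrite -mulmx_tr_row_eq0 -vstate_norm.
have cT' := commutantT Linv cT; have cA' := commutantT Linv cA.
rewrite trmx_mul mulmxA tauC //; last by do !apply: commutantM.
by rewrite /vstate !mulmxA -mulmxA Tw mulmx0 mxE.
Qed.

Lemma vstate_proj_gt0 P : is_proj P -> N P -> P != 0 -> 0 < tau P.
Proof.
move=> [Ps PP] cP P0; have E := vstate_norm P; rewrite Ps PP in E.
rewrite E lt_neqAle mulmx_tr_row_ge0 andbT eq_sym mulmx_tr_row_eq0.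
apply: contra P0 => /eqP/(congr1 trmx); rewrite trmxK trmx0 => Pw.
by apply/eqP; apply: separating_vector.
Qed.

Lemma scale_proj_ge0 k (A : 'M[F]_(k, m)) P a : is_proj P -> P != 0 ->
  A^T *m A = a *: P -> 0 <= a.
Proof.
move=> [Ps PP] P0 AE.
have [i Pi] : exists i, row i P != 0.
  apply: contrapT => H; case/eqP: P0; apply/row_matrixP => i; rewrite row0.
  by apply/eqP/negPn/negP => Pi; apply: H; exists i.
have : 0 <= a * (row i P *m (row i P)^T) 0 0.
  have -> : a * (row i P *m (row i P)^T) 0 0 = (A^T *m A) i i.
    rewrite AE [RHS]mxE; congr (_ * _); rewrite mulmx_tr_rowE -[in RHS]PP mxE.
    by apply: eq_bigr => j _; rewrite !mxE -[in P j i]Ps mxE.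
  rewrite mxE; apply: sumr_ge0 => j _; rewrite mxE -expr2; exact: sqr_ge0.
rewrite pmulr_lge0 // lt_neqAle mulmx_tr_row_ge0 andbT eq_sym.
by rewrite mulmx_tr_row_eq0.
Qed.

(** Polar decomposition: both A A^t and A^t A are scalar in their corners, so
    A is a positive multiple of a partial isometry. *)
Lemma minimal_isometry P Q A : minimal P -> minimal Q -> N A ->
  P *m A = A -> A *m Q = A -> A != 0 ->
  exists T c, [/\ N T, T *m T^T = P, T^T *m T = Q & A = c *: T].
Proof.
move=> mP mQ cA PA AQ A0.
have [[Ps PP] cP P0 _] := mP; have [[Qs QQ] cQ Q0 _] := mQ.
have cA' := commutantT Linv cA.
have PA' : A^T *m P = A^T by rewrite -{1}Ps -trmx_mul PA.
have AQ' : Q *m A^T = A^T by rewrite -{1}Qs -trmx_mul AQ.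
have [a aE] : exists a, A *m A^T = a *: P.
  apply: (minimal_sym_scalar Linv mP); first exact: commutantM.
  - by rewrite mulmxA PA.
  - by rewrite -mulmxA PA'.
  - by rewrite trmx_mul trmxK.
have [b bE] : exists b, A^T *m A = b *: Q.
  apply: (minimal_sym_scalar Linv mQ); first exact: commutantM.
  - by rewrite mulmxA AQ'.
  - by rewrite -mulmxA AQ.
  - by rewrite trmx_mul trmxK.
have ab : a = b.
  have : a *: A = b *: A.
    by rewrite -{1}PA scalemxAl -aE -mulmxA bE -scalemxAr AQ.
  move/eqP; rewrite -subr_eq0 -scalerBl scaler_eq0 (negPf A0) orbF subr_eq0.
  by move/eqP.
have b0 : 0 < b.
  rewrite lt_neqAle (scale_proj_ge0 (conj Qs QQ) Q0 bE) andbT eq_sym.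
  apply: contra A0 => /eqP b0; apply/eqP/trmx_inj; rewrite trmx0.
  by apply: mulmx_tr_eq0; rewrite trmxK bE b0 scale0r.
have s0 : Num.sqrt b != 0 by rewrite sqrtr_eq0 -ltNge.
have ss : (Num.sqrt b)^-1 * (Num.sqrt b)^-1 * b = 1.
  by rewrite -invfM -expr2 sqr_sqrtr ?ltW // mulVf // lt0r_neq0.
exists ((Num.sqrt b)^-1 *: A), (Num.sqrt b); split.
- exact: commutantZ.
- by rewrite [(_ *: A)^T]linearZ /= -scalemxAl -scalemxAr aE ab !scalerA ss scale1r.
- by rewrite [(_ *: A)^T]linearZ /= -scalemxAl -scalemxAr bE !scalerA ss scale1r.
- by rewrite scalerA divff // scale1r.
Qed.

Section Corner.
Variable P : 'M[F]_m.
Hypothesis mP : minimal P.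

Definition corner x := [/\ N x, P *m x = x & x *m P = x].

Lemma minimal_facts : [/\ P^T = P, P *m P = P, N P & 0 < tau P].
Proof.
have [[Ps PP] cP P0 _] := mP; split=> //; exact: vstate_proj_gt0.
Qed.

Lemma corner_id : corner P.
Proof. by have [_ PP cP _] := minimal_facts. Qed.
Lemma cornerM x y : corner x -> corner y -> corner (x *m y).
Proof.
move=> [cx Px xP] [cy Py yP]; split; first exact: commutantM.
  by rewrite mulmxA Px.
by rewrite -mulmxA yP.
Qed.
Lemma cornerD x y : corner x -> corner y -> corner (x + y).
Proof.
move=> [cx Px xP] [cy Py yP]; split; first exact: commutantD.
  by rewrite mulmxDr Px Py.
by rewrite mulmxDl xP yP.
Qed.
Lemma cornerZ a x : corner x -> corner (a *: x).
Proof.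
move=> [cx Px xP]; split; first exact: commutantZ.
  by rewrite -scalemxAr Px.
by rewrite -scalemxAl xP.
Qed.
Lemma cornerT x : corner x -> corner x^T.
Proof.
have [Ps _ _ _] := minimal_facts.
move=> [cx Px xP]; split; first exact: commutantT.
  by rewrite -{1}Ps -trmx_mul xP.
by rewrite -{1}Ps -trmx_mul Px.
Qed.

Lemma corner_sym x : corner x -> x^T = x -> x = (tau x / tau P) *: P.
Proof.
have [_ _ _ P0] := minimal_facts.
move=> [cx Px xP] /(minimal_sym_scalar Linv mP cx Px xP) [a ->].
by rewrite vstateZ mulfK // lt0r_neq0.
Qed.

Lemma skew_unit x : corner x -> x^T = - x -> x != 0 ->
  exists i c, [/\ corner i, i^T = - i, i *m i = - P & x = c *: i].
Proof.
move=> hx xs x0; have [cx Px xP] := hx.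
have [T [c [cT TP _ xE]]] := minimal_isometry mP mP cx Px xP x0.
have c0 : c != 0 by apply: contraNneq x0 => c0; rewrite xE c0 scale0r.
have TE : T = c^-1 *: x by rewrite xE scalerA mulVf // scale1r.
have Ts : T^T = - T by rewrite TE linearZ /= xs scalerN.
exists T, c; split=> //; first by rewrite TE; exact: cornerZ.
by rewrite -TP Ts mulmxN opprK.
Qed.

Lemma vstate_skew x : x^T = - x -> tau x = 0.
Proof. move=> xs; have := vstateT w x; rewrite xs vstateN; lra. Qed.

(** The anticommutator is symmetric, hence a multiple of P, and the multiple
    is read off from its state. *)
Lemma skew_anticommute x y : corner x -> corner y -> x^T = - x -> y^T = - y ->
  tau (x *m y) = 0 -> y *m x = - (x *m y).
Proof.
move=> hx hy xs ys xy0; have [cx _ _] := hx; have [cy _ _] := hy.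
have := corner_sym (cornerD (cornerM hx hy) (cornerM hy hx)).
rewrite linearD /= !trmx_mul xs ys !mulNmx !mulmxN !opprK addrC => /(_ erefl).
rewrite vstateD (tauC cy cx) xy0 addr0 mul0r scale0r => /eqP.
by rewrite addr_eq0 => /eqP ->; rewrite opprK.
Qed.

(** Fourier expansion. The symmetric part of x is a multiple of P; the skew
    part minus its projection on us is orthogonal to us, so it vanishes when
    us is maximal. *)
Lemma corner_expansion (us : seq 'M[F]_m) : uniq us ->
  {in us, forall u, corner u /\ u^T = - u} ->
  {in us &, forall u v, tau (u *m v) = - (tau P *+ (u == v))} ->
  (forall x, corner x -> x^T = - x -> {in us, forall u, tau (x *m u) = 0} -> x = 0) ->
  forall x, corner x ->
    x = \sum_(u <- P :: us) (tau (x *m u^T) / tau P) *: u.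
Proof.
have [Ps PP cP P0] := minimal_facts; have d0 := lt0r_neq0 P0.
move=> uq us_skew us_orth us_max x hx; have [cx Px xP] := hx.
pose s := 2^-1 *: (x + x^T); pose k := 2^-1 *: (x - x^T).
have two0 : (2 : F) != 0 by rewrite pnatr_eq0.
have xsk : x = s + k.
  by rewrite -scalerDr addrCA addrC addrK -mulr2n -scaler_nat scalerA mulVf // scale1r.
have hxT := cornerT hx.
have hs : corner s by apply/cornerZ/cornerD.
have hk : corner k by apply/cornerZ/cornerD => //; rewrite -scaleN1r; apply: cornerZ.
have ss : s^T = s by rewrite linearZ linearD /= trmxK addrC.
have ks : k^T = - k by rewrite linearZ linearB /= trmxK -scalerN opprB.
have tk := vstate_skew ks.
have tx : tau x = tau s by rewrite {1}xsk vstateD tk addr0.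
have sE := corner_sym hs ss; rewrite -tx in sE.
have txu u : u \in us -> tau (x *m u) = tau (k *m u).
  move=> /us_skew [[cu Pu uP] us']; rewrite {1}xsk mulmxDl vstateD sE -scalemxAl.
  by rewrite vstateZ Pu (vstate_skew us') mulr0 add0r.
pose k' := k + \sum_(u <- us) (tau (k *m u) / tau P) *: u.
have hsum (r : seq 'M[F]_m) (f : 'M[F]_m -> F) : {subset r <= us} ->
    corner (\sum_(u <- r) f u *: u) /\
    (\sum_(u <- r) f u *: u)^T = - \sum_(u <- r) f u *: u.
  elim: r => [|u r IH] ru.
    rewrite !big_nil trmx0 oppr0; split=> //; rewrite -(scale0r P).
    exact: cornerZ corner_id.
  have [h1 h2] := IH (fun v hv => ru v (mem_behead (s := u :: r) hv)).
  have [h3 h4] := us_skew u (ru u (mem_head _ _)).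
  rewrite !big_cons linearD linearZ /= h2 h4 opprD scalerN; split=> //.
  by apply: cornerD => //; apply: cornerZ.
have [h1 h2] := hsum us (fun u => tau (k *m u) / tau P) (fun _ h => h).
have k'0 : k' = 0.
  apply: us_max; first exact: cornerD.
    by rewrite linearD /= ks h2 opprD.
  move=> v hv; rewrite mulmxDl mulmx_suml vstateD vstate_sum.
  rewrite (bigD1_seq v) //= -[_ *: v *m v]scalemxAl.
  rewrite [tau (_ *: (v *m v))]vstateZ (us_orth v v) // eqxx mulr1n.
  rewrite mulrN divfK // big_seq_cond big1 ?addr0 ?subrr // => u /andP [hu uv].
  by rewrite -scalemxAl vstateZ (us_orth u v) // (negPf uv) mulr0n oppr0 mulr0.
rewrite big_cons Ps xP {1}xsk -{1}sE; congr (_ + _).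
move/eqP: k'0; rewrite addr_eq0 => /eqP ->; rewrite -sumrN !big_seq.
apply: eq_bigr => u hu; have [_ us'] := us_skew u hu.
by rewrite us' mulmxN vstateN txu // mulNr scaleNr.
Qed.

(** The three cases are the corners isomorphic to F, F[i] and the quaternions
    over F. *)
Variant corner_basis : seq 'M[F]_m -> Prop :=
| CornerReal : corner_basis [:: P]
| CornerComplex i : corner i -> i^T = - i -> i *m i = - P ->
    corner_basis [:: P; i]
| CornerQuaternion i j : corner i -> corner j -> i^T = - i -> j^T = - j ->
    i *m i = - P -> j *m j = - P -> j *m i = - (i *m j) ->
    corner_basis [:: P; i; j; i *m j].

(** Frobenius' theorem. Skew elements orthogonal for tau anticommute, so that
    i and j produce the third unit i j, and a fourth one would both commute
    and anticommute with i j. *)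
Lemma corner_basis_exists : exists us, corner_basis us /\
  forall x, corner x -> x = \sum_(u <- us) (tau (x *m u^T) / tau P) *: u.
Proof.
have [Ps PP cP P0] := minimal_facts; have d0 := lt0r_neq0 P0.
have [H0|] := pselect (forall x, corner x -> x^T = - x -> x = 0).
  exists [:: P]; split; first by constructor.
  by apply: corner_expansion => // x hx xs _; apply: H0.
move=> nH0.
have [i [hi is_ ii]] : exists i, [/\ corner i, i^T = - i & i *m i = - P].
  apply: contrapT => H; apply: nH0 => x hx xs; apply/eqP/negPn/negP => x0.
  by have [i [c [? ? ? _]]] := skew_unit hx xs x0; apply: H; exists i.
have [H1|nH1] := pselect (forall x, corner x -> x^T = - x -> tau (x *m i) = 0 -> x = 0).
  exists [:: P; i]; split; first by constructor.
  apply: corner_expansion => //.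
  - by move=> u; rewrite inE => /eqP ->.
  - by move=> u v; rewrite !inE => /eqP -> /eqP ->; rewrite eqxx ii vstateN.
  - by move=> x hx xs H; apply: H1 => //; apply: H; rewrite inE.
have [j [hj js jj ji]] : exists j,
    [/\ corner j, j^T = - j, j *m j = - P & tau (j *m i) = 0].
  apply: contrapT => H; apply: nH1 => x hx xs xi; apply/eqP/negPn/negP => x0.
  have [j [c [? ? ? xE]]] := skew_unit hx xs x0; apply: H; exists j; split=> //.
  have c0 : c != 0 by apply: contraNneq x0 => c0; rewrite xE c0 scale0r.
  by move/eqP: xi; rewrite xE -scalemxAl vstateZ mulf_eq0 (negPf c0) => /eqP.
have [ci Pi iP] := hi; have [cj Pj jP] := hj.
have ij : i *m j = - (j *m i) by apply: skew_anticommute.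
have ji' : j *m i = - (i *m j) by rewrite ij opprK.
have hij := cornerM hi hj.
have ijs : (i *m j)^T = - (i *m j).
  by rewrite trmx_mul is_ js mulNmx mulmxN opprK.
have ijij : i *m j *m (i *m j) = - P.
  rewrite -mulmxA (mulmxA j i) ji' mulNmx mulmxN -mulmxA jj !mulmxN iP.
  by rewrite opprK ii.
have ti := vstate_skew is_; have tj := vstate_skew js; have tij := vstate_skew ijs.
have t_ij : tau (i *m j) = 0 by [].
have iij : i *m (i *m j) = - j by rewrite mulmxA ii mulNmx Pj.
have iji : i *m j *m i = j by rewrite -mulmxA ji' mulmxN iij opprK.
have ijj : i *m j *m j = - i by rewrite -mulmxA jj mulmxN iP.
have jij : j *m (i *m j) = i by rewrite mulmxA ji' mulNmx ijj opprK.
have tt a : tau (a *m a) != 0 -> forall b, tau (a *m b) = 0 -> a != b.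
  by move=> ha b hb; apply: contraNneq ha => {2}->; rewrite hb.
have tN : tau (- P) != 0 by rewrite vstateN oppr_eq0.
have i_j : i != j by apply: tt => //; rewrite ii.
have i_ij : i != i *m j by apply: tt; rewrite ?ii // iij vstateN tj oppr0.
have j_ij : j != i *m j by apply: tt; rewrite ?jj // jij.
exists [:: P; i; j; i *m j]; split; first by constructor.
apply: corner_expansion.
- by rewrite /= !inE !negb_or i_j i_ij j_ij.
- by move=> u; rewrite !inE => /or3P [] /eqP ->.
- have E := (i_j, i_ij, j_ij, eq_sym j i, eq_sym (i *m j) i, eq_sym (i *m j) j).
  move=> u v; rewrite !inE => /or3P [] /eqP -> /or3P [] /eqP ->;
  by rewrite ?eqxx ?(negPf i_j) ?(negPf i_ij) ?(negPf j_ij)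
    1?[j == i]eq_sym 1?[i *m j == i]eq_sym 1?[i *m j == j]eq_sym
    ?(negPf i_j) ?(negPf i_ij) ?(negPf j_ij)
    ?ii ?jj ?ijij ?iij ?iji ?ijj ?jij ?ji ?vstateN ?tij ?ti ?tj ?mulr0n ?oppr0.
move=> x hx xs H.
have [cx Px xP] := hx.
have xi : x *m i = - (i *m x).
  rewrite (@skew_anticommute x i) ?opprK //.
  by apply: H; rewrite !inE eqxx.
have xj : x *m j = - (j *m x).
  rewrite (@skew_anticommute x j) ?opprK //.
  by apply: H; rewrite !inE eqxx ?orbT.
have xij : x *m (i *m j) = - (i *m j *m x).
  rewrite (@skew_anticommute x (i *m j)) ?opprK //.
  by apply: H; rewrite !inE eqxx ?orbT.
(* anticommuting with i and j, x commutes with i j *)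
have xij' : x *m (i *m j) = i *m j *m x.
  by rewrite (mulmxA x) xi mulNmx -(mulmxA i x) xj mulmxN opprK mulmxA.
have z : x *m (i *m j) = 0.
  have : 2 *: (x *m (i *m j)) == 0.
    by rewrite scaler_nat mulr2n {1}xij xij' addNr.
  by rewrite scaler_eq0 pnatr_eq0 => /eqP.
have := congr1 (mulmx^~ (i *m j)) z; rewrite mul0mx -mulmxA ijij mulmxN xP => /eqP.
by rewrite oppr_eq0 => /eqP.
Qed.

Lemma corner_basis_unitary us : corner_basis us ->
  {in us, forall u, [/\ corner u, u *m u^T = P & u^T *m u = P]}.
Proof.
have [Ps PP cP P0] := minimal_facts; have hP := corner_id.
have sk x : corner x -> x^T = - x -> x *m x = - P ->
    [/\ corner x, x *m x^T = P & x^T *m x = P].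
  by move=> hx xs xx; rewrite xs mulmxN mulNmx xx opprK.
have u1 : [/\ corner P, P *m P^T = P & P^T *m P = P] by rewrite Ps.
case=> [|i hi si ii|i j hi hj si sj ii jj ji] u; rewrite !inE.
- by move/eqP->.
- by move=> /orP [] /eqP -> //; apply: sk.
case/or4P => /eqP -> //; try exact: sk.
apply: sk; first exact: cornerM.
  by rewrite trmx_mul si sj mulNmx mulmxN opprK.
by rewrite -mulmxA (mulmxA j) ji mulNmx mulmxN -mulmxA jj !mulmxN opprK;
  case: hi => _ _ ->; rewrite ii.
Qed.
End Corner.

(** Murray-von Neumann equivalence. *)
Definition proj_equiv (Q P : 'M[F]_m) :=
  `[< exists T, [/\ N T, T *m T^T = P & T^T *m T = Q] >].

Lemma proj_equiv_sym P Q : proj_equiv Q P = proj_equiv P Q.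
Proof.
by apply/asboolP/asboolP => -[T [cT TP TQ]]; exists T^T; rewrite trmxK; split=> //;
  exact: commutantT.
Qed.

Lemma isometry_left (T P : 'M[F]_m) :
  P^T = P -> P *m P = P -> T *m T^T = P -> P *m T = T.
Proof.
move=> Ps PP TP; apply/eqP; rewrite -subr_eq0; apply/eqP/mulmx_tr_eq0.
have TPP : T *m (T^T *m P) = P by rewrite mulmxA TP PP.
by rewrite linearB /= trmx_mul Ps mulmxBl !mulmxBr -!mulmxA TP TPP PP !subrr.
Qed.

Lemma proj_equiv_refl P : minimal P -> proj_equiv P P.
Proof. by move=> [[Ps PP] cP _ _]; apply/asboolP; exists P; rewrite Ps. Qed.

Lemma proj_equiv_trans P Q R : minimal P -> minimal Q -> minimal R ->
  proj_equiv P Q -> proj_equiv Q R -> proj_equiv P R.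
Proof.
move=> [[Ps PP] _ _ _] [[Qs QQ] _ _ _] [[Rs RR] _ _ _].
move=> /asboolP [T [cT TQ TP]] /asboolP [T' [cT' TR TQ']].
apply/asboolP; exists (T' *m T); split; first exact: commutantM.
  rewrite trmx_mul mulmxA -(mulmxA T' T) TQ -TQ' mulmxA TR -mulmxA TR RR //.
rewrite trmx_mul -mulmxA (mulmxA T'^T) TQ' -{1}TQ -!mulmxA TP.
by rewrite mulmxA TP PP.
Qed.

Section TraceFormula.
Variables (P : 'M[F]_m) (us : seq 'M[F]_m).
Hypotheses (mP : minimal P) (us_basis : corner_basis P us).
Hypothesis us_expansion : forall x, corner P x ->
  x = \sum_(u <- us) (tau (x *m u^T) / tau P) *: u.

(** When T carries Q to P, the vectors u T w, for u in the basis of the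
    corner, form an orthogonal family. M is the corresponding sum of rank one
    operators; it acts on A w as P A Q does, while its trace against b only
    involves Q. *)
Lemma block_trace Q : minimal Q -> exists M,
  (forall A, N A -> P *m A *m Q *m w = M *m (A *m w)) /\
  (forall b, (forall T, N T -> b *m T = T *m b) ->
     tau P * \tr (b *m M) = (proj_equiv Q P)%:R * ((size us)%:R * tau (b *m Q))).
Proof.
move=> mQ; have [Ps PP cP P0] := minimal_facts mP.
have [Qs QQ cQ _] := minimal_facts mQ; have d0 := lt0r_neq0 P0.
have [eQ|nQ] := boolP (proj_equiv Q P); last first.
  exists 0; split=> [A cA|b cb]; last by rewrite mulmx0 mxtrace0 mulr0 mul0r.
  have [->|B0] := eqVneq (P *m A *m Q) 0; first by rewrite !mul0mx.
  case/negP: nQ; have cB : N (P *m A *m Q) by do !apply: commutantM.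
  have [||T [c [cT TP TQ _]]] := minimal_isometry mP mQ cB _ _ B0.
  - by rewrite !mulmxA PP.
  - by rewrite -mulmxA QQ.
  by apply/asboolP; exists T.
have /asboolP [T [cT TP TQ]] := eQ.
have PT := isometry_left Ps PP TP.
have TP' : T^T *m P = T^T by rewrite -{1}Ps -trmx_mul PT.
have cT' := commutantT Linv cT.
have uni := corner_basis_unitary mP us_basis.
exists (\sum_(u <- us) (tau P)^-1 *: ((u *m T *m w) *m (u *m T *m w)^T)); split.
  move=> A cA; pose x := P *m A *m T^T.
  have cx : corner P x.
    split; first by do !apply: commutantM.
      by rewrite /x !mulmxA PP.
    by rewrite /x -mulmxA TP'.
  have -> : P *m A *m Q = x *m T by rewrite /x -TQ !mulmxA.
  rewrite {1}(us_expansion cx) !mulmx_suml !big_seq; apply: eq_bigr => u hu.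
  have [[cu Pu uP] _ _] := uni u hu; have cu' := commutantT Linv cu.
  have uP' : u^T *m P = u^T by rewrite -{1}Ps -trmx_mul Pu.
  have -> : tau (x *m u^T) = tau (T^T *m u^T *m A).
    rewrite /x -!mulmxA tauC //; last by do !apply: commutantM.
    by rewrite -!mulmxA uP' tauC //; do ?apply: commutantM => //; rewrite mulmxA.
  rewrite -!scalemxAl mulrC -scalerA; congr (_ *: _).
  rewrite -[RHS]mulmxA; set y := u *m T *m w.
  have -> : y^T *m (A *m w) = (tau (T^T *m u^T *m A))%:M.
    by rewrite [LHS]mx11_scalar /vstate /y !trmx_mul !mulmxA.
  by rewrite mul_mx_scalar.
move=> b cb; rewrite mul1r mulmx_sumr raddf_sum /= mulr_sumr.
transitivity (\sum_(u <- us) tau (b *m Q)); last first.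
  by rewrite big_const_seq count_predT iter_addr_0 mulr_natl.
rewrite !big_seq; apply: eq_bigr => u hu; have [[cu Pu uP] _ uu] := uni u hu.
rewrite -scalemxAr mxtraceZ mulrA divff // mul1r mulmxA mxtrace_mulC mulmxA.
rewrite trace_mx11 /vstate !trmx_mul; congr (_ 0 0).
have cu' := commutantT Linv cu.
rewrite -!mulmxA; congr (_ *m _); rewrite !mulmxA; congr (_ *m _).
rewrite -(mulmxA _ u^T b) -(cb _ cu') mulmxA -(cb _ cT') -!mulmxA; congr (_ *m _).
by rewrite (mulmxA u^T) uu PT TQ.
Qed.

(** The operators M of [block_trace] add up to P, since the vector w is cyclic
    and the projections of Qs add up to 1. *)
Lemma corner_trace (Qs : seq 'M[F]_m) b : {in Qs, forall Q, minimal Q} ->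
  \sum_(Q <- Qs) Q = 1%:M -> (forall T, N T -> b *m T = T *m b) ->
  tau P * \tr (b *m P) =
  (size us)%:R * \sum_(Q <- Qs | proj_equiv Q P) tau (b *m Q).
Proof.
move=> mQs sQs cb.
have [M [MA Mb]] : exists M,
  (forall A, N A -> P *m A *m (\sum_(Q <- Qs) Q) *m w = M *m (A *m w)) /\
  tau P * \tr (b *m M) =
    (size us)%:R * \sum_(Q <- Qs | proj_equiv Q P) tau (b *m Q).
  elim: Qs mQs {sQs} => [|Q Qs IH] mQs.
    exists 0; rewrite !big_nil mulmx0 mxtrace0 !mulr0; split=> // A _.
    by rewrite mulmx0 !mul0mx.
  have [|M [MA Mb]] := IH; first by move=> R hR; apply: mQs; rewrite inE hR orbT.
  have [M' [MA' Mb']] := block_trace (mQs _ (mem_head _ _)).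
  exists (M' + M); split=> [A cA|].
    by rewrite big_cons mulmxDr !mulmxDl MA // MA'.
  rewrite big_cons mulmxDr mxtraceD mulrDr Mb Mb' //.
  by case: proj_equiv; rewrite ?mul1r ?mul0r ?add0r // mulrDr.
rewrite -Mb; congr (_ * \tr (_ *m _)); apply/eqP; rewrite -subr_eq0; apply/eqP.
apply: trmx_inj; apply/row_matrixP => j; rewrite trmx0 row0 -tr_col colE.
have [A cA <-] := cyclic_w (delta_mx j 0).
by rewrite mulmxBl -MA // sQs mulmx1 mulmxA subrr trmx0.
Qed.
End TraceFormula.

Definition realizable (f : seq I -> F) := exists k (Y : I -> 'M[F]_k),
  (forall i, Y (inv i) = (Y i)^T) /\ forall v, \tr (word_prod Y v) = f v.

Lemma eq_realizable f f' : f =1 f' -> realizable f -> realizable f'.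
Proof. by move=> ff' [k [Y [Y1 Y2]]]; exists k, Y; split=> // v; rewrite Y2. Qed.

Lemma realizable0 : realizable (fun=> 0).
Proof.
exists 0%N, (fun=> 0); split=> [i|v]; first by rewrite trmx0.
by rewrite /mxtrace big_ord0.
Qed.

Lemma realizableD f f' : realizable f -> realizable f' ->
  realizable (fun v => f v + f' v).
Proof.
move=> [k [Y [Y1 Y2]]] [k' [Y' [Y1' Y2']]].
exists (k + k')%N, (fun i => block_mx (Y i) 0 0 (Y' i)); split=> [i|v].
  by rewrite tr_block_mx !trmx0 Y1 Y1'.
suff -> : word_prod (fun i => block_mx (Y i) 0 0 (Y' i)) v =
  block_mx (word_prod Y v) 0 0 (word_prod Y' v) by rewrite mxtrace_block Y2 Y2'.
rewrite /word_prod; elim: v => [|i v IH]; first by rewrite !big_nil -scalar_mx_block.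
by rewrite !big_cons IH mulmx_block !mulmx0 !mul0mx !addr0 !add0r.
Qed.

Lemma realizableMn f n : realizable f -> realizable (fun v => n%:R * f v).
Proof.
move=> rf; elim: n => [|n IH].
  by apply: eq_realizable realizable0 => v; rewrite mul0r.
by apply: eq_realizable (realizableD rf IH) => v; rewrite -natr1 mulrDl mul1r addrC.
Qed.

(** Compress the letters to the image of P, in orthonormal coordinates. *)
Lemma realizable_corner P : is_proj P -> N P ->
  realizable (fun v => \tr (word_prod L v *m P)).
Proof.
move=> [Ps PP] cP; have [Q QQ QK] := orthonormal_rows P.
have QP : Q *m P = Q.
  have /submxP [D ->] : (Q <= P)%MS by rewrite QK.
  by rewrite -mulmxA PP.
have PE : Q^T *m Q = P.
  have /submxP [D DE] : (P <= Q)%MS by rewrite QK.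
  have E : P *m (Q^T *m Q) = P.
    transitivity (D *m Q *m (Q^T *m Q)); first by congr (_ *m _).
    by rewrite -mulmxA (mulmxA Q) QQ mul1mx -DE.
  by have := congr1 trmx E; rewrite !trmx_mul trmxK Ps -mulmxA QP.
exists (\rank P), (fun i => Q *m L i *m Q^T); split=> [i|v].
  by rewrite Linv !trmx_mul trmxK mulmxA.
suff -> : word_prod (fun i => Q *m L i *m Q^T) v = Q *m word_prod L v *m Q^T.
  by rewrite mxtrace_mulC mulmxA PE mxtrace_mulC.
rewrite /word_prod; elim: v => [|i v IH]; first by rewrite !big_nil mulmx1 QQ.
rewrite !big_cons IH !mulmxA; congr (_ *m _ *m _).
by rewrite -!mulmxA PE cP mulmxA QP.
Qed.

Lemma word_prod_commute v T : N T -> word_prod L v *m T = T *m word_prod L v.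
Proof.
move=> cT; rewrite /word_prod; elim: v => [|i v IH].
  by rewrite big_nil mul1mx mulmx1.
by rewrite !big_cons -mulmxA IH mulmxA cT mulmxA.
Qed.

(** Grouping a decomposition of 1 into classes of equivalent minimal
    projections, each class contributes the trace of the compression to one of
    its members, with multiplicity tau P / size us. *)
Theorem tracial_realizable :
  (forall P us, minimal P -> corner_basis P us ->
    exists k, tau P = (size us * k)%:R) ->
  realizable (fun v => tau (word_prod L v)).
Proof.
move=> Hint.
have [Qs [mQs sQs]] :=
  minimal_decomposition (conj (trmx1 _ _) (mul1mx _)) (commutant1 L).
have class_real P : minimal P ->
    realizable (fun v => \sum_(Q <- Qs | proj_equiv Q P) tau (word_prod L v *m Q)).
  move=> mP; have [us [usB usE]] := corner_basis_exists mP.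
  have [k tP] := Hint P us mP usB.
  have [pP cP _ _] := mP.
  apply: eq_realizable (realizableMn k (realizable_corner pP cP)) => v.
  have := corner_trace mP usB usE mQs sQs (@word_prod_commute v).
  have [_ _ _ P0] := minimal_facts mP.
  have us0 : (size us)%:R != 0 :> F by rewrite pnatr_eq0; case: usB.
  by rewrite tP natrM -mulrA => /(mulfI us0).
(* any union of classes is exhausted by removing one class at a time *)
have sub_real (p : pred 'M[F]_m) :
    {in Qs &, forall P Q, proj_equiv Q P -> p Q = p P} ->
    realizable (fun v => \sum_(Q <- Qs | p Q) tau (word_prod L v *m Q)).
  have [n] := ubnP (count p Qs); elim: n p => // n IH p; rewrite ltnS => cn hp.
  have [/hasP [P hP pP]|/hasPn np] := boolP (has p Qs); last first.
    apply: eq_realizable realizable0 => v.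
    by rewrite big_seq_cond big1 // => Q /andP [/np /negPf ->].
  have mP := mQs _ hP.
  pose p' Q := p Q && ~~ proj_equiv Q P.
  have c1 (r : seq 'M[F]_m) :
      (count (fun Q => p Q && proj_equiv Q P) r + count p' r = count p r)%N.
    elim: r => //= Q r <-; rewrite /p'.
    by case: (p Q) => //=; case: proj_equiv => /=; rewrite ?addnS ?addSn.
  have c2 : (count p' Qs < n)%N.
    apply: leq_trans cn; rewrite -c1 -[ltnLHS]add0n ltn_add2r -has_count.
    by apply/hasP; exists P; rewrite //= pP proj_equiv_refl.
  have hp' : {in Qs &, forall R Q, proj_equiv Q R -> p' Q = p' R}.
    move=> R Q hR hQ QR; rewrite /p' (hp R Q hR hQ QR).
    suff -> : proj_equiv Q P = proj_equiv R P by [].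
    have [mR mQ] := (mQs R hR, mQs Q hQ).
    apply/idP/idP; last exact: proj_equiv_trans.
    by apply: proj_equiv_trans => //; rewrite proj_equiv_sym.
  apply: eq_realizable (realizableD (class_real P mP) (IH p' c2 hp')) => v.
  rewrite [RHS](bigID (fun Q => proj_equiv Q P)) /=; congr (_ + _).
  rewrite big_seq_cond [RHS]big_seq_cond; apply: eq_bigl => Q.
  case hQ: (Q \in Qs) => //=; case e: (proj_equiv Q P); rewrite ?andbF ?andbT //.
  by rewrite (hp P Q).
apply: eq_realizable (sub_real predT _) => // v.
by rewrite -vstate_sum -mulmx_sumr sQs mulmx1.
Qed.
End TracialCommutant.

(** * Nilpotent, idempotent and skew-symmetric matrices *)

Lemma mxtrace_hornerX (K : fieldType) n (Z : 'M[K]_n.+1) (p : {poly K}) :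
  (forall k, \tr (Z ^+ k.+1) = 0) -> \tr (horner_mx Z (p * 'X)) = 0.
Proof.
move=> Z0; elim/poly_ind: p => [|p c IH]; first by rewrite mul0r rmorph0 mxtrace0.
suff H (q : {poly K}) k : \tr (horner_mx Z q *m Z ^+ k.+1) = 0.
  by have := H (p * 'X + c%:P) 0%N; rewrite expr1 rmorphM /= horner_mx_X.
elim/poly_ind: q k {p c IH} => [|q c IH] k; first by rewrite rmorph0 mul0mx mxtrace0.
rewrite rmorphD rmorphM /= horner_mx_X horner_mx_C mulmxDl mxtraceD.
have -> : horner_mx Z q * Z *m Z ^+ k.+1 = horner_mx Z q *m Z ^+ k.+2.
  by rewrite !mulmxE -mulrA -exprS.
by rewrite IH add0r mul_scalar_mx mxtraceZ Z0 mulr0.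
Qed.

(** Fitting decomposition by polynomials: Bezout for X^(a+1) and the part of
    the characteristic polynomial prime to X gives an idempotent polynomial in
    Z without constant term. Its trace, which is its rank, vanishes. *)
Lemma nilpotent_of_mxtrace (K : fieldType) n (Z : 'M[K]_n.+1) :
  [pchar K] =i pred0 -> (forall k, \tr (Z ^+ k.+1) = 0) -> exists N, Z ^+ N = 0.
Proof.
move=> chK Z0; pose p := char_poly Z.
have p0 : p != 0 by rewrite monic_neq0 // char_poly_monic.
have [a [q + pE]] := multiplicity_XsubC p 0.
rewrite p0 /= subr0 in pE * => q0.
have : coprimep ('X ^+ a.+1) q.
  by rewrite coprimep_expl // coprimep_sym -['X]subr0 -polyC0 coprimep_XsubC.
case/Bezout_eq1_coprimepP => -[u v] /= uv.
pose E := horner_mx Z (u * 'X^(a.+1)).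
have pZ : horner_mx Z p = 0 := Cayley_Hamilton Z.
have EE : E *m (1%:M - E) = 0.
  have -> : 1%:M - E = horner_mx Z (v * q).
    by rewrite /E -[X in X - _](rmorph1 (horner_mx Z)) -rmorphB -uv addrC addKr.
  rewrite mulmxE -rmorphM.
  have -> : u * 'X^(a.+1) * (v * q) = u * 'X * v * p by rewrite pE exprS; ring.
  by rewrite rmorphM /= pZ mulr0.
have EE' : E *m E = E.
  by apply/eqP; rewrite -subr_eq0 -oppr_eq0 opprB -{1}(mulmx1 E) -mulmxBr EE.
have E0 : E = 0.
  apply/eqP; rewrite -mxrank_eq0; have := mxtrace_idem EE'.
  rewrite /E exprSr mulrA mxtrace_hornerX // => /esym/eqP.
  by have /pcharf0P -> := chK.
exists a; have := congr1 (horner_mx Z) uv.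
rewrite rmorph1 rmorphD /= [horner_mx Z (u * _)]E0 add0r.
move=> vq; rewrite -[LHS]mul1r -vq -{2}(horner_mx_X Z) -rmorphXn -rmorphM.
by rewrite -mulrA -pE rmorphM /= pZ mulr0.
Qed.

(** Modulo (X^2 - X)^N the polynomial 1 - (1 - X^N)^N is idempotent: it is
    divisible by X^N, and 1 minus it by (1 - X)^N. *)
Lemma idempotent_correction (K : fieldType) n (F : 'M[K]_n.+1) N :
  (F ^+ 2 - F) ^+ N = 0 ->
  let E := 1 - (1 - F ^+ N) ^+ N in E *m E = E.
Proof.
move=> FN E; pose e : {poly K} := 1 - (1 - 'X ^+ N) ^+ N.
have EE : E = horner_mx F e.
  by rewrite rmorphB rmorphXn rmorphB rmorphXn /= horner_mx_X rmorph1.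
have [s sE] : exists s, e = 'X ^+ N * s.
  exists (\sum_(i < N) (1 - 'X ^+ N) ^+ i).
  by rewrite /e -opprB subrX1 -mulNr opprB subKr.
have [s' s'E] : exists s, 1 - e = (1 - 'X) ^+ N * s.
  exists ((\sum_(i < N) 'X ^+ i) ^+ N).
  by rewrite /e subKr -exprMn -[1 - 'X ^+ N]opprB subrX1 -mulNr opprB.
apply/eqP; rewrite -subr_eq0 -oppr_eq0 opprB -{1}(mulmx1 E) -mulmxBr EE.
rewrite -[X in _ *m (X - _)](rmorph1 (horner_mx F)) -rmorphB mulmxE -rmorphM.
rewrite s'E sE.
have -> : 'X ^+ N * s * ((1 - 'X) ^+ N * s') =
    ('X ^+ 2 - 'X) ^+ N * ((-1) ^+ N * s * s').
  have -> : 'X ^+ 2 - 'X = -1 * ('X * (1 - 'X)) :> {poly K} by ring.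
  rewrite !exprMn.
  have : (-1) ^+ N * (-1) ^+ N = 1 :> {poly K} by rewrite -expr2 sqrr_sign.
  by move=> E1; rewrite -[LHS]mul1r -[X in X * _ = _]E1; ring.
by rewrite rmorphM rmorphXn rmorphB rmorphXn /= horner_mx_X FN mul0r.
Qed.

(** Write A = Q^t S Q with S invertible and skew of size the rank, and compare
    the determinants of S and S^t = - S. *)
Lemma skew_rank_even (K : fieldType) n (A : 'M[K]_n) :
  (2 : K) != 0 -> A^T = - A -> ~~ odd (\rank A).
Proof.
move=> two0 As; pose r := \rank A.
have : exists C : 'M_(n, r), exists2 Q : 'M_(r, n), row_free Q & A = C *m Q.
  by exists (col_base A), (row_base A); rewrite ?mulmx_base ?row_base_free.
have : \rank A = r by []; move: r => r rA [C [Q Qf AE]].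
pose S := - (C^T *m pinvmx Q).
have AS : A = Q^T *m S *m Q.
  have -> : Q^T *m S = C.
    rewrite /S mulmxN mulmxA -trmx_mul -AE As mulNmx opprK.
    by rewrite [X in X *m _]AE -mulmxA mulmxVp // mulmx1.
  exact: AE.
have Ss : S^T = - S.
  have QTf : row_full Q^T by rewrite /row_full mxrank_tr.
  apply: (row_full_inj QTf); apply: (row_free_inj Qf).
  by rewrite mulmxN mulNmx -AS -As AS !trmx_mul trmxK mulmxA.
have Su : S \in unitmx.
  rewrite -row_free_unit /row_free eqn_leq rank_leq_row -{1}rA AS.
  exact: leq_trans (mxrankM_maxl _ _) (mxrankM_maxr _ _).
have := det_tr S; rewrite Ss -scaleN1r detZ => dS.
rewrite rA; apply: contraL two0 => odr; rewrite negbK.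
move/eqP: dS; rewrite -signr_odd odr expr1 mulN1r eq_sym -subr_eq0 opprK.
have dS0 : \det S != 0 by rewrite -unitfE -unitmxE.
by rewrite -mulr2n -[\det S *+ 2]mulr_natl mulf_eq0 (negPf dS0) orbF.
Qed.

Lemma nilpotent_add1_unit (K : fieldType) n (V : 'M[K]_n.+1) N :
  V ^+ N = 0 -> 1%:M + V \in unitmx.
Proof.
move=> VN; have : (1%:M + V) *m \sum_(i < N) (- V) ^+ i = 1%:M.
  have := subrX1 (- V) N; rewrite exprNn VN mulr0 sub0r -opprD mulNr.
  by move=> /oppr_inj; rewrite addrC mulmxE.
by case/mulmx1_unit.
Qed.

(** * Lifting a commutant to matrices of prescribed size *)

Section Lifting.
Variables (K : fieldType) (I : Type) (inv : I -> I) (n m : nat).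
Variables (X : I -> 'M[K]_n.+1) (R : I -> 'M[K]_m.+1) (w : 'cV[K]_m.+1).
Hypotheses (charK : [pchar K] =i pred0).
Hypotheses (Xinv : forall i, X (inv i) = (X i)^T).
Hypotheses (Rinv : forall i, R (inv i) = (R i)^T).

Local Notation state := (vstate w).
Hypothesis X_state : forall v, \tr (word_prod X v) = state (word_prod R v).

(** The algebra of pairs generated by (X_l, R_l). By [lifted_mxtrace] the
    matrix Z has the trace prescribed by T alone, although Z is only
    determined by T up to the radical of the trace form. *)
Inductive lifted : 'M[K]_n.+1 -> 'M[K]_m.+1 -> Prop :=
| lifted1 : lifted 1%:M 1%:M
| lifted_gen i : lifted (X i) (R i)
| liftedD Z T Z' T' : lifted Z T -> lifted Z' T' -> lifted (Z + Z') (T + T')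
| liftedZ a Z T : lifted Z T -> lifted (a *: Z) (a *: T)
| liftedM Z T Z' T' : lifted Z T -> lifted Z' T' -> lifted (Z *m Z') (T *m T').

(** The stronger statement, with an arbitrary factor on the left and an
    arbitrary word on the right, is stable under the constructors of [lifted]. *)
Lemma lifted_mxtrace Z T : lifted Z T -> \tr Z = state T.
Proof.
move=> ZT.
suff H M M' : (forall v, \tr (M *m word_prod X v) = state (M' *m word_prod R v)) ->
    forall v, \tr (M *m Z *m word_prod X v) = state (M' *m T *m word_prod R v).
  have := H 1%:M 1%:M _ [::]; rewrite /word_prod !big_nil !mul1mx !mulmx1; apply.
  by move=> v; rewrite !mul1mx X_state.
elim: ZT M M' => {Z T}
  [|i|Z T Z' T' _ IH _ IH'|a Z T _ IH|Z T Z' T' _ IH _ IH'] M M' H v.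
- by rewrite !mulmx1.
- by have := H (i :: v); rewrite /word_prod !big_cons !mulmxA.
- by rewrite !mulmxDr !mulmxDl mxtraceD vstateD (IH M M') // (IH' M M').
- by rewrite -!scalemxAr -!scalemxAl mxtraceZ vstateZ (IH M M').
- by rewrite !mulmxA; apply: IH' => v'; apply: IH.
Qed.

Lemma liftedT Z T : lifted Z T -> lifted Z^T T^T.
Proof.
elim=> {Z T} [|i|Z T Z' T' _ IH _ IH'|a Z T _ IH|Z T Z' T' _ IH _ IH'].
- by rewrite !trmx1; constructor.
- by rewrite -Xinv -Rinv; constructor.
- by rewrite !linearD /=; apply: liftedD.
- by rewrite !linearZ /=; apply: liftedZ.
- by rewrite !trmx_mul; apply: liftedM.
Qed.

Lemma liftedB Z T Z' T' : lifted Z T -> lifted Z' T' -> lifted (Z - Z') (T - T').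
Proof.
by move=> h /(liftedZ (-1)); rewrite !scaleN1r; apply: liftedD.
Qed.

Lemma liftedX Z T k : lifted Z T -> lifted (Z ^+ k) (T ^+ k).
Proof.
move=> h; elim: k => [|k IH]; first by rewrite !expr0; exact: lifted1.
by rewrite !exprS -!mulmxE; apply: liftedM.
Qed.

(** All powers of Z lift 0, hence have trace 0. *)
Lemma lifted0_nilpotent Z : lifted Z 0 -> exists N, Z ^+ N.+1 = 0.
Proof.
move=> h; have [k|N ZN] := nilpotent_of_mxtrace charK (Z := Z).
  rewrite (lifted_mxtrace (liftedX k.+1 h)) expr0n /=.
  by rewrite /vstate mulmx0 mul0mx mxE.
by exists N; rewrite exprS ZN mulr0.
Qed.

Lemma idem_expS (T : 'M[K]_m.+1) k : T *m T = T -> T ^+ k.+1 = T.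
Proof. by move=> TT; elim: k => // k IH; rewrite exprS IH -mulmxE. Qed.

Lemma idempotent_lift f : (exists F, lifted F f) -> f *m f = f ->
  exists E, [/\ lifted E f, E *m E = E & state f = (\rank E)%:R].
Proof.
move=> [F hF] ff.
have h0 : lifted (F ^+ 2 - F) 0.
  have -> : 0 = f ^+ 2 - f by rewrite idem_expS // subrr.
  by apply: liftedB => //; apply: liftedX.
have [N FN] := lifted0_nilpotent h0.
pose E := 1 - (1 - F ^+ N.+1) ^+ N.+1.
have EE : E *m E = E := idempotent_correction FN.
have hE : lifted E f.
  have -> : f = 1%:M - (1%:M - f ^+ N.+1) ^+ N.+1.
    rewrite (idem_expS _ ff) idem_expS ?subKr //.
    by rewrite mulmxBl !mulmxBr !mulmx1 !mul1mx ff subrr subr0.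
  apply: liftedB; first exact: lifted1.
  apply: liftedX; apply: liftedB; first exact: lifted1.
  exact: liftedX.
by exists E; split=> //; rewrite -(lifted_mxtrace hE) mxtrace_idem.
Qed.

(** In the corner of the lifted idempotent E, the skew matrix A lifting mm is
    invertible modulo a nilpotent, so that A and E have the same rank. *)
Lemma idempotent_state_even f mm m' : (exists F, lifted F f) -> f *m f = f ->
  (exists Z, lifted Z mm) -> (exists Z, lifted Z m') ->
  mm^T = - mm -> f^T *m mm *m f = mm -> m' *m mm = f ->
  exists k, state f = (k * 2)%:R.
Proof.
move=> hf ff [Z hZ] [Z' hZ'] ms fmf m'm.
have [E [hE EE sE]] := idempotent_lift hf ff.
have two0 : (2 : K) != 0 by have /pcharf0P -> := charK.
pose A := E^T *m (2^-1 *: (Z - Z^T)) *m E.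
have As : A^T = - A.
  rewrite /A !trmx_mul trmxK linearZ linearB /= trmxK -mulmxA.
  by rewrite -opprB scalerN mulNmx mulmxN mulmxA.
have hA : lifted A mm.
  have E2 : mm = 2^-1 *: (mm - mm^T).
    by rewrite ms opprK -mulr2n -scaler_nat scalerA mulVf // scale1r.
  rewrite -fmf {1}E2; apply: liftedM => //; apply: liftedM; first exact: liftedT.
  by apply: liftedZ; apply: liftedB => //; apply: liftedT.
pose V := E *m Z' *m A.
have hV : lifted (V - E) 0.
  have -> : 0 = f *m m' *m mm - f by rewrite -mulmxA m'm ff subrr.
  by apply: liftedB => //; do 2!apply: liftedM => //.
have [N VN] := lifted0_nilpotent hV.
have rV : \rank V = \rank E.
  have U := nilpotent_add1_unit VN.
  have -> : V = E *m (1%:M + (V - E)).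
    have EV : E *m V = V by rewrite /V !mulmxA EE.
    by rewrite mulmxDr mulmx1 mulmxBr EV EE addrC subrK.
  by rewrite mxrankMfree // row_free_unit.
have rA : \rank A = \rank E.
  apply/eqP; rewrite eqn_leq mxrankM_maxr /= -rV.
  exact: mxrankM_maxr.
have := skew_rank_even two0 As; rewrite rA => ev.
by exists (\rank E)./2; rewrite sE muln2 even_halfK.
Qed.
End Lifting.

(** The basis us of the corner has 1, 2 or 4 elements. In the last case the
    state of P is twice that of f, which is even. *)
Lemma liftings_divisibility (F : rcfType) (K : fieldType) (kappa : {rmorphism F -> K})
  (iK : K) (I : Type) (inv : I -> I) (n m : nat)
  (X : I -> 'M[K]_n.+1) (L R : I -> 'M[F]_m.+1) (w : 'cV[F]_m.+1) :
  iK * iK = -1 ->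
  (forall i, X (inv i) = (X i)^T) ->
  (forall i, L (inv i) = (L i)^T) ->
  (forall i, R (inv i) = (R i)^T) ->
  (forall v, \tr (word_prod X v) = kappa (vstate w (word_prod R v))) ->
  (forall A B, commutant L A -> commutant L B ->
     vstate w (A *m B) = vstate w (B *m A)) ->
  (forall v : 'cV[F]_m.+1, exists2 A, commutant L A & A *m w = v) ->
  (forall T, commutant L T -> exists Z,
     lifted X (fun i => map_mx kappa (R i)) Z (map_mx kappa T)) ->
  forall P us, minimal_proj L P -> corner_basis L P us ->
    exists k, vstate w P = (size us * k)%:R.
Proof.
move=> ii Xinv Linv Rinv Xt tauC cyc hl P us mP usB.
have charK : [pchar K] =i pred0.
  by move=> p; rewrite (fmorph_pchar kappa) pchar_num.
have two0 : (2 : K) != 0 by have /pcharf0P -> := charK.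
pose wK := map_mx kappa w; pose RK i := map_mx kappa (R i).
have RKinv i : RK (inv i) = (RK i)^T by rewrite /RK Rinv map_trmx.
have stE T : vstate wK (map_mx kappa T) = kappa (vstate w T).
  by rewrite /vstate /wK map_trmx -!map_mxM [LHS]mxE.
have XtK v : \tr (word_prod X v) = vstate wK (word_prod RK v).
  rewrite Xt -stE; congr (vstate _ _); rewrite /word_prod.
  elim: v => [|i v IH]; first by rewrite !big_nil map_mx1.
  by rewrite !big_cons map_mxM IH.
have [Ps PP cP P0] := minimal_facts Linv tauC cyc mP.
have P_idem : map_mx kappa P *m map_mx kappa P = map_mx kappa P by rewrite -map_mxM PP.
have inj (a : F) k : kappa a = k%:R -> a = k%:R.
  by move=> h; apply: (fmorph_inj kappa); rewrite h rmorph_nat.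
case: usB => [|i hi is_ ii_|i j hi hj is_ js ii_ jj ji] /=.
- have [E [_ _ sE]] := idempotent_lift charK XtK (hl P cP) P_idem.
  by exists (\rank E); apply: inj; rewrite -stE sE mul1n.
- have [ci Pi iP] := hi.
  have [||||k sE] := @idempotent_state_even K I inv n m X RK wK charK Xinv RKinv XtK
    (map_mx kappa P) (map_mx kappa i) (map_mx kappa (- i)) (hl P cP) P_idem (hl i ci).
  + by apply: hl; rewrite -scaleN1r; apply: commutantZ.
  + by rewrite map_trmx is_ map_mxN.
  + by rewrite map_trmx Ps -!map_mxM Pi iP.
  + by rewrite -map_mxM mulNmx ii_ opprK.
  by exists k; apply: inj; rewrite -stE sE mulnC.
have [ci Pi iP] := hi; have [cj Pj jP] := hj.
(* f projects onto an eigenspace of i; its transpose onto the other one, and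
   the skew element j exchanges the two *)
pose f := 2^-1 *: (map_mx kappa P - iK *: map_mx kappa i).
have fT : f^T = 2^-1 *: (map_mx kappa P + iK *: map_mx kappa i).
  rewrite /f linearZ /= linearB /= [(_ *: _)^T]linearZ /=.
  by rewrite !map_trmx Ps is_ map_mxN scalerN opprK.
pose kj := map_mx kappa j.
have kjj : kj *m kj = - map_mx kappa P by rewrite -map_mxM jj map_mxN.
have jf : kj *m f = f^T *m kj.
  rewrite fT -scalemxAl -scalemxAr mulmxBr mulmxDl -scalemxAl -scalemxAr.
  by rewrite -!map_mxM jP Pj ji map_mxN scalerN opprK.
have ff : f *m f = f.
  have E : (map_mx kappa P - iK *: map_mx kappa i) *m
      (map_mx kappa P - iK *: map_mx kappa i) =
      2 *: (map_mx kappa P - iK *: map_mx kappa i).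
    rewrite mulmxBl !mulmxBr -!scalemxAl -!scalemxAr -!map_mxM PP Pi iP ii_.
    by rewrite map_mxN scalerA ii scaleN1r opprK opprB scaler_nat mulr2n.
  by rewrite -scalemxAl -scalemxAr E [2^-1 *: (2 *: _)]scalerA mulVf // scale1r.
have Pf : map_mx kappa P *m f = f.
  by rewrite -scalemxAr mulmxBr -scalemxAr -!map_mxM PP Pi.
have lf : exists Z, lifted X RK Z f.
  have [Z hZ] := hl P cP; have [Z' hZ'] := hl i ci.
  by exists (2^-1 *: (Z - iK *: Z')); apply/liftedZ/liftedB/liftedZ.
have [Zf hf] := lf; have [Zj hZj] := hl j cj.
have [|||||k sE] := @idempotent_state_even K I inv n m X RK wK charK Xinv RKinv XtK
    f (kj *m f) (- kj) lf ff.
- by exists (Zj *m Zf); apply: liftedM.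
- by exists (-1 *: Zj); rewrite -scaleN1r; apply: liftedZ.
- by rewrite trmx_mul jf map_trmx js map_mxN mulmxN.
- by rewrite mulmxA -jf -!mulmxA !ff.
- by rewrite mulNmx mulmxA kjj mulNmx opprK Pf.
exists k; apply: inj.
have ti : vstate w i = 0 by apply: vstate_skew.
have : vstate wK f = 2^-1 * kappa (vstate w P).
  by rewrite vstateZ vstateD -scaleNr vstateZ !stE ti rmorph0 mulr0 addr0.
rewrite sE => E; have -> : kappa (vstate w P) = 2 * (k * 2)%:R.
  by rewrite E mulrA divff // mul1r.
by rewrite !natrM; ring.
Qed.

(** * The Fischer inner product *)

Section LinearExtension.
Variables (A : comNzRingType) (N : nat) (u : 'X_{1..N} -> A).

Definition mnm_lin (p : {mpoly A[N]}) : A := \sum_(m <- msupp p) p@_m * u m.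

Lemma mnm_lin_widen (s : seq 'X_{1..N}) p : uniq s -> {subset msupp p <= s} ->
  mnm_lin p = \sum_(m <- s) p@_m * u m.
Proof.
move=> us ps; rewrite (bigID (fun m => m \in msupp p)) /= [X in _ = _ + X]big1 ?addr0.
  rewrite -big_filter; apply: perm_big; apply: uniq_perm.
  - exact: msupp_uniq.
  - exact: filter_uniq.
  by move=> m; rewrite mem_filter; case h: (m \in msupp p); rewrite //= ps.
by move=> m /memN_msupp_eq0 ->; rewrite mul0r.
Qed.

Lemma mnm_linP a p q : mnm_lin (a *: p + q) = a * mnm_lin p + mnm_lin q.
Proof.
have us := undup_uniq (msupp (a *: p + q) ++ msupp p ++ msupp q).
rewrite !(mnm_lin_widen us) => [|m hm|m hm|m hm];
  try by rewrite mem_undup !mem_cat hm ?orbT.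
rewrite mulr_sumr -big_split; apply: eq_bigr => m _ /=.
by rewrite mcoeffD mcoeffZ mulrDl mulrA.
Qed.

Lemma mnm_linX m : mnm_lin 'X_[m] = u m.
Proof. by rewrite /mnm_lin msuppX big_seq1 mcoeffX eqxx mul1r. Qed.
Lemma mnm_lin0 : mnm_lin 0 = 0.
Proof. by rewrite /mnm_lin msupp0 big_nil. Qed.
Lemma mnm_linD p q : mnm_lin (p + q) = mnm_lin p + mnm_lin q.
Proof. by rewrite -{1}(scale1r p) mnm_linP mul1r. Qed.
Lemma mnm_linZ a p : mnm_lin (a *: p) = a * mnm_lin p.
Proof. by rewrite -{1}(addr0 (a *: p)) mnm_linP mnm_lin0 addr0. Qed.
End LinearExtension.

Section Fischer.
Variables (F : realFieldType) (N : nat).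
Implicit Types (p q : {mpoly F[N]}) (m : 'X_{1..N}).

Definition mnm_fact m : nat := (\prod_(i < N) (m i)`!)%N.

(** The Fischer inner product: p, read as a differential operator with
    constant coefficients, applied to q and evaluated at 0. *)
Definition fischer p q : F := mnm_lin (fun m => q@_m * (mnm_fact m)%:R) p.

Lemma fischerE p q :
  fischer p q = \sum_(m <- msupp p) p@_m * q@_m * (mnm_fact m)%:R.
Proof. by apply: eq_bigr => m _; rewrite mulrA. Qed.

Lemma fischerC p q : fischer p q = fischer q p.
Proof.
have us := undup_uniq (msupp p ++ msupp q).
rewrite /fischer !(mnm_lin_widen _ us); last 2 first.
- by move=> m h; rewrite mem_undup mem_cat h orbT.
- by move=> m h; rewrite mem_undup mem_cat h.
by apply: eq_bigr => m _; rewrite mulrCA.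
Qed.

Lemma fischerDl p q r : fischer (p + q) r = fischer p r + fischer q r.
Proof. exact: mnm_linD. Qed.
Lemma fischerZl a p q : fischer (a *: p) q = a * fischer p q.
Proof. exact: mnm_linZ. Qed.
Lemma fischer0l p : fischer 0 p = 0.
Proof. exact: mnm_lin0. Qed.
Lemma fischerDr p q r : fischer p (q + r) = fischer p q + fischer p r.
Proof. by rewrite fischerC fischerDl !(fischerC _ p). Qed.
Lemma fischerZr a p q : fischer p (a *: q) = a * fischer p q.
Proof. by rewrite fischerC fischerZl fischerC. Qed.
Lemma fischer0r p : fischer p 0 = 0.
Proof. by rewrite fischerC fischer0l. Qed.
Lemma fischerBl p q r : fischer (p - q) r = fischer p r - fischer q r.
Proof. by rewrite fischerDl -scaleN1r fischerZl mulN1r. Qed.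
Lemma fischer_sumr (J : Type) (s : seq J) (P : pred J) f p :
  fischer p (\sum_(j <- s | P j) f j) = \sum_(j <- s | P j) fischer p (f j).
Proof. exact: (big_morph _ (fischerDr p) (fischer0r p)). Qed.
Lemma fischer_suml (J : Type) (s : seq J) (P : pred J) f p :
  fischer (\sum_(j <- s | P j) f j) p = \sum_(j <- s | P j) fischer (f j) p.
Proof. by rewrite fischerC fischer_sumr; apply: eq_bigr => j _; rewrite fischerC. Qed.

Lemma fischer_ge0 p : 0 <= fischer p p.
Proof.
by rewrite fischerE; apply: sumr_ge0 => m _; rewrite mulr_ge0 ?ler0n // -expr2 sqr_ge0.
Qed.

Lemma fischer_eq0 p : fischer p p = 0 -> p = 0.
Proof.
rewrite fischerE => /eqP; rewrite psumr_eq0; last first.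
  by move=> m _; rewrite mulr_ge0 ?ler0n // -expr2 sqr_ge0.
move=> /allP H; apply/mpolyP => m; rewrite mcoeff0.
have [/H|/memN_msupp_eq0 //] := boolP (m \in msupp p).
rewrite /= mulf_eq0 -expr2 sqrf_eq0 pnatr_eq0 => /orP [/eqP //|].
rewrite -[_ == _]negbK -lt0n prodn_gt0 // => i; exact: fact_gt0.
Qed.

Lemma fischerX m q : fischer 'X_[m] q = q@_m * (mnm_fact m)%:R.
Proof. exact: mnm_linX. Qed.

Lemma fischer_mulX i p q : fischer ('X_i * p) q = fischer p q^`M(i).
Proof.
elim/mpolyind: p => [|c m p _ _ IH]; first by rewrite mulr0 !fischer0l.
rewrite mulrDr !fischerDl IH; congr (_ + _).
rewrite -scalerAr !fischerZl -mpolyXD !fischerX mcoeff_mderiv [(m + _)%MM]addmC.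
rewrite mulrnAl -mulrnAr -mulrnA; congr (_ * (_ * _%:R)).
rewrite /mnm_fact (bigD1 i) //= [in RHS](bigD1 i) //= mnmDE mnm1E eqxx add1n factS.
rewrite -mulnA [RHS]mulnC; congr (_ * (_ * _))%N; apply: eq_bigr => j ji.
by rewrite mnmDE mnm1E eq_sym (negPf ji) add0n.
Qed.

(** Monomials are orthogonal. *)
Lemma fischer_homog d e p q : d != e -> p \is d.-homog -> q \is e.-homog ->
  fischer p q = 0.
Proof.
move=> de hp hq; rewrite fischerE big_seq big1 // => m hm.
rewrite (dhomog_nemf_coeff hq) ?mulr0 ?mul0r //.
by rewrite (dhomog_mf hp hm).
Qed.
End Fischer.

(** * Differential operators on the trace ring *)

Lemma mul_delta_mxE (A : nzRingType) n (a : 'M[A]_n) (c d i j : 'I_n) :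
  (a *m delta_mx c d) i j = a i c *+ (d == j).
Proof.
rewrite !mxE (bigD1 c) //= mxE eqxx big1 => [|r rc].
  by rewrite addr0 mulr_natr eq_sym.
by rewrite mxE (negPf rc) mulr0.
Qed.

Lemma mderiv_var (R : nzRingType) N (i k : 'I_N) :
  ('X_k : {mpoly R[N]})^`M(i) = (k == i)%:R.
Proof.
rewrite mderivX mnm1E; case: eqP => [->|_]; last by rewrite scale0r.
rewrite scale1r; have -> : (U_(i) - U_(i) = 0)%MM.
  by apply/mnmP => j; rewrite mnmBE subnn mnm0E.
by rewrite mpolyX0.
Qed.

Section TraceRing.
Variables (R : realType) (g n : nat).
Local Notation poly := (xi_poly R g n).
Local Notation MP := 'M[poly]_n.
Local Notation letter := ('I_g * bool)%type.
Local Notation wmx := (@word_mx R g n).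
Local Notation lmx := (@letter_mx R g n).
Local Notation TR := (@trace_ring R g n).

Definition flip_letter (l : letter) : letter := (l.1, ~~ l.2).

Definition letter_var (l : letter) (p q : 'I_n) : 'I_#|xi_index g n| :=
  enum_rank ((if l.2 then (l.1, q, p) else (l.1, p, q)) : xi_index g n).

Lemma letter_mxE l p q : lmx l p q = 'X_(letter_var l p q).
Proof. by rewrite /letter_mx /letter_var; case: l => j [] /=; rewrite !mxE. Qed.

Lemma letter_mx_flip l : lmx (flip_letter l) = (lmx l)^T.
Proof. by case: l => j []; rewrite /letter_mx /= ?trmxK. Qed.

Lemma trace_ring1 : TR 1%:M.
Proof. by have := trace_ring_scalar g n (1 : R); rewrite scale1r. Qed.

Lemma trace_ring0 : TR 0.
Proof. by have := trace_ring_scalar g n (0 : R); rewrite scale0r raddf0. Qed.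

Lemma trace_ring_poly_scale (f : poly) h : TR f%:M -> TR h -> TR (f *: h).
Proof. by move=> Tf Th; rewrite -mul_scalar_mx; apply: trace_ring_mul. Qed.

Lemma trace_ring_word w : TR (wmx w).
Proof.
elim: w => [|l w IH]; first by rewrite /word_mx big_nil; exact: trace_ring1.
by rewrite word_mx_cons; apply: trace_ring_mul => //; apply: trace_ring_letter.
Qed.

Lemma word_mx_rcons w l : wmx (rcons w l) = wmx w *m lmx l.
Proof.
elim: w => [|k w IH]; first by rewrite /= word_mx_cons /word_mx !big_nil mulmx1 mul1mx.
by rewrite rcons_cons !word_mx_cons IH mulmxA.
Qed.

(** Products are unfolded to the left of a word, so that only traces of words
    and sums and products of polynomials remain. *)
Lemma trace_ring_mxtrace_ind (P : poly -> Prop) :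
  (forall c : R, P c%:MP) -> (forall w, P (\tr (wmx w))) ->
  (forall a b, P a -> P b -> P (a + b)) -> (forall a b, P a -> P b -> P (a * b)) ->
  forall h, TR h -> P (\tr h).
Proof.
move=> Pc Pw PD PM h Th.
suff Q (m : MP) : (forall w, P (\tr (m *m wmx w))) ->
    forall w, P (\tr (m *m h *m wmx w)).
  have := Q 1%:M _ [::]; rewrite /word_mx big_nil mul1mx mulmx1; apply=> w.
  by rewrite mul1mx; exact: Pw.
elim: Th m => {h} [l|v|c|a b _ IHa _ IHb|a b _ IHa _ IHb] m Hm w.
- by rewrite -mulmxA -word_mx_cons.
- rewrite scalar_mxC -mulmxA mul_scalar_mx mxtraceZ; exact: PM.
- rewrite scalar_mxC -mulmxA mul_scalar_mx mxtraceZ; apply: PM => //.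
  by rewrite alg_mpolyC.
- by rewrite mulmxDr mulmxDl mxtraceD; apply: PD; [apply: IHa|apply: IHb].
- by rewrite mulmxA; apply: IHb => v; apply: IHa.
Qed.

(** Polynomials in the centre are, up to the factor n, traces of elements of
    the trace ring. *)
Lemma Tcenter_ind (hn : (0 < n)%N) (P : poly -> Prop) :
  (forall c : R, P c%:MP) -> (forall w, P (\tr (wmx w))) ->
  (forall a b, P a -> P b -> P (a + b)) -> (forall a b, P a -> P b -> P (a * b)) ->
  forall f, TR f%:M -> P f.
Proof.
move=> Pc Pw PD PM f Tf.
have -> : f = (n%:R^-1)%:MP * \tr (f%:M : MP).
  rewrite mxtrace_scalar mul_mpolyC -scaler_nat scalerA mulVf ?scale1r //.
  by rewrite pnatr_eq0 -lt0n.
exact (PM _ _ (Pc _) (trace_ring_mxtrace_ind Pc Pw PD PM Tf)).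
Qed.

Definition dmx (l : letter) (p q : 'I_n) (h : MP) : MP :=
  map_mx (mderiv (letter_var l p q)) h.

Lemma dmxD l p q a b : dmx l p q (a + b) = dmx l p q a + dmx l p q b.
Proof. by apply/matrixP => i j; rewrite !mxE mderivD. Qed.

Lemma dmxM l p q a b : dmx l p q (a *m b) = dmx l p q a *m b + a *m dmx l p q b.
Proof.
apply/matrixP => i j; rewrite !mxE raddf_sum -big_split; apply: eq_bigr => k _ /=.
by rewrite mderivM !mxE.
Qed.

Lemma dmx_const l p q (c : R) : dmx l p q (c%:MP)%:M = 0.
Proof.
by apply/matrixP => i j; rewrite !mxE raddfMn /= mderivC mul0rn.
Qed.

Lemma dmx_letter l k p q : dmx l p q (lmx k) =
  if l.1 == k.1 then if l.2 == k.2 then delta_mx p q else delta_mx q p else 0.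
Proof.
apply/matrixP => i j; rewrite mxE letter_mxE mderiv_var /letter_var.
rewrite (inj_eq enum_rank_inj); case: l k => [a b] [a' b'] /=.
have D (c d c' d' : 'I_n) : ((a', c, d) == (a, c', d') :> xi_index g n) =
    [&& a == a', c == c' & d == d'].
  by rewrite !xpair_eqE (eq_sym a') andbA.
have -> : ((if b' then (a', j, i) else (a', i, j)) ==
      (if b then (a, q, p) else (a, p, q))
    :> xi_index g n) = (a == a') && (if b == b' then (i == p) && (j == q)
      else (i == q) && (j == p)).
  by case: b b' => [] []; rewrite D //= (andbC (j == _)).
case: eqP => /= [_|_]; last by rewrite mxE.
by case: eqP => _; rewrite mxE.
Qed.

(** The gradient, with respect to the matrix variable l, of tr (a b) with a
    held constant. *)
Definition grad_tr (l : letter) (a b : MP) : MP :=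
  \matrix_(p, q) \tr (a *m dmx l p q b).

(** The derivatives act on b only. The factor a makes the operator compatible
    with products in b, which the plain divergence of b is not. *)
Definition divergence (l : letter) (a b : MP) : MP :=
  \matrix_(p, s) \sum_q (a *m dmx l p q b) q s.

Lemma grad_tr_letter l k a : TR a -> TR (grad_tr l a (lmx k)).
Proof.
move=> Ta.
have E' p q : \tr (a *m delta_mx p q) = a q p.
  rewrite /mxtrace (bigD1 q) //= mul_delta_mxE eqxx big1 ?addr0 // => i iq.
  by rewrite mul_delta_mxE eq_sym (negPf iq).
case e1: (l.1 == k.1); last first.
  suff -> : grad_tr l a (lmx k) = 0 by apply: trace_ring0.
  by apply/matrixP => p q; rewrite !mxE dmx_letter e1 mulmx0 mxtrace0.
case e2: (l.2 == k.2).
  suff -> : grad_tr l a (lmx k) = a^T by apply: trace_ring_trmx.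
  by apply/matrixP => p q; rewrite !mxE dmx_letter e1 e2 E'.
suff -> : grad_tr l a (lmx k) = a by [].
by apply/matrixP => p q; rewrite !mxE dmx_letter e1 e2 E'.
Qed.

(** The product rule and cyclicity of the trace reduce a word to its letters. *)
Lemma grad_tr_word l w a : TR a -> TR (grad_tr l a (wmx w)).
Proof.
elim: w a => [|k w IH] a Ta.
  suff -> : grad_tr l a (wmx [::]) = 0 by apply: trace_ring0.
  by apply/matrixP => p q; rewrite /word_mx big_nil !mxE dmx_const mulmx0 mxtrace0.
have -> : grad_tr l a (wmx (k :: w)) =
    grad_tr l (wmx w *m a) (lmx k) + grad_tr l (a *m lmx k) (wmx w).
  apply/matrixP => p q; rewrite !mxE word_mx_cons dmxM mulmxDr mxtraceD mulmxA.
  by rewrite mxtrace_mulC !mulmxA.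
apply: trace_ring_add.
  apply: grad_tr_letter; apply: trace_ring_mul => //; exact: trace_ring_word.
by apply: IH; apply: trace_ring_mul => //; apply: trace_ring_letter.
Qed.

(** By the product rule only generators b matter: letters contribute a^t or tr
    a, and traces of words contribute a gradient. *)
Lemma divergence_closed l a b : TR a -> TR b -> TR (divergence l a b).
Proof.
move=> Ta Tb; elim: Tb a Ta => {b} [k|w|c|b1 b2 _ IH1 _ IH2|b1 b2 T1 IH1 T2 IH2] a Ta.
- have E := mul_delta_mxE a.
  case e1: (l.1 == k.1); last first.
    have -> : divergence l a (lmx k) = 0; last exact: trace_ring0.
    apply/matrixP => p s; rewrite !mxE big1 // => q _.
    by rewrite dmx_letter e1 mulmx0 mxE.
  case e2: (l.2 == k.2).
    have -> : divergence l a (lmx k) = a^T; last exact: trace_ring_trmx.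
    apply/matrixP => p s; rewrite !mxE (bigD1 s) //= dmx_letter e1 e2 E // eqxx.
    rewrite big1 ?addr0 // => q qs; rewrite dmx_letter e1 e2 E //.
    by rewrite (negPf qs).
  have -> : divergence l a (lmx k) = (\tr a)%:M; last exact: trace_ring_tr.
  apply/matrixP => p s; rewrite !mxE /mxtrace -sumrMnl; apply: eq_bigr => q _.
  by rewrite dmx_letter e1 e2 E.
- have -> : divergence l a (\tr (wmx w))%:M = grad_tr l 1%:M (wmx w) *m a.
    apply/matrixP => p s; rewrite !mxE; apply: eq_bigr => q _.
    have -> : dmx l p q (\tr (wmx w))%:M = (\tr (dmx l p q (wmx w)))%:M.
      apply/matrixP => i j; rewrite !mxE raddfMn /= raddf_sum /=.
      by congr (_ *+ _); apply: eq_bigr => t _; rewrite mxE.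
    by rewrite mul_mx_scalar [LHS]mxE /grad_tr [in RHS]mxE mul1mx.
  by apply: trace_ring_mul => //; apply: grad_tr_word; exact: trace_ring1.
- have -> : divergence l a (c%:A)%:M = 0.
    apply/matrixP => p s; rewrite !mxE big1 // => q _.
    by rewrite alg_mpolyC dmx_const mulmx0 mxE.
  exact: trace_ring0.
- have -> : divergence l a (b1 + b2) = divergence l a b1 + divergence l a b2.
    apply/matrixP => p s; rewrite !mxE -big_split; apply: eq_bigr => q _ /=.
    by rewrite dmxD mulmxDr mxE.
  by apply: trace_ring_add; [apply: IH1|apply: IH2].
have -> : divergence l a (b1 *m b2) =
    divergence l a b1 *m b2 + divergence l (a *m b1) b2.
  apply/matrixP => p s; rewrite !mxE.
  transitivity (\sum_q ((a *m dmx l p q b1 *m b2) q s + (a *m b1 *m dmx l p q b2) q s)).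
    by apply: eq_bigr => q _; rewrite dmxM mulmxDr !mulmxA mxE.
  rewrite big_split; congr (_ + _) => /=.
  under eq_bigr do rewrite mxE.
  by rewrite exchange_big; apply: eq_bigr => t _; rewrite mxE mulr_suml.
apply: trace_ring_add; first by apply: trace_ring_mul => //; apply: IH1.
by apply: IH2; apply: trace_ring_mul.
Qed.

End TraceRing.

(** * The Reynolds operator *)

Section Reynolds.
Variables (R : realType) (g n : nat).
Hypothesis hn : (0 < n)%N.
Local Notation poly := (xi_poly R g n).
Local Notation MP := 'M[poly]_n.
Local Notation letter := ('I_g * bool)%type.
Local Notation wmx := (@word_mx R g n).
Local Notation lmx := (@letter_mx R g n).
Local Notation TR := (@trace_ring R g n).
Local Notation hproj := (pihomog mdeg).

Definition perp (f : poly) := forall h, TR h%:M -> fischer f h = 0.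

Lemma perpD f f' : perp f -> perp f' -> perp (f + f').
Proof. by move=> pf pf' h Th; rewrite fischerDl pf // pf' // addr0. Qed.

(** Adjunction moves the letters of w one by one to H, where each becomes a
    divergence; what is left is the product of f with a trace. *)
Lemma perp_word f w H : perp f -> TR H ->
  \sum_p \sum_s fischer (wmx w p s * f) (H s p) = 0.
Proof.
move=> pf; elim/last_ind: w H => [|w l IH] H TH.
  rewrite -[RHS](pf (\tr H)); last exact: trace_ring_tr.
  rewrite fischer_sumr; apply: eq_bigr => p _.
  rewrite (bigD1 p) //= /word_mx big_nil mxE eqxx mul1r big1 ?addr0 // => s sp.
  by rewrite mxE eq_sym (negPf sp) mul0r fischer0l.
rewrite -[RHS](IH (divergence l 1%:M H)); last first.
  by apply: divergence_closed => //; exact: trace_ring1.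
apply: eq_bigr => p _.
transitivity (\sum_s \sum_q
  fischer (wmx w p q * f) (mderiv (letter_var l q s) (H s p))).
  apply: eq_bigr => s _; rewrite word_mx_rcons mxE mulr_suml fischer_suml.
  apply: eq_bigr => q _; rewrite letter_mxE -fischer_mulX; congr (fischer _ _).
  by rewrite mulrCA mulrA.
rewrite exchange_big; apply: eq_bigr => q _ /=; rewrite mxE fischer_sumr.
by apply: eq_bigr => s _; rewrite mul1mx mxE.
Qed.

Lemma perp_trace f w : perp f -> perp (\tr (wmx w) * f).
Proof.
move=> pf h Th; rewrite -[RHS](perp_word w pf Th) mulr_suml fischer_suml.
apply: eq_bigr => p _; rewrite (bigD1 p) //= mxE eqxx mulr1n big1 ?addr0 // => s sp.
by rewrite mxE (negPf sp) fischer0r.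
Qed.

Lemma trace_ring_scalar_sum (J : Type) (r : seq J) (f : J -> poly) :
  (forall j, TR (f j)%:M) -> TR (\sum_(j <- r) f j)%:M.
Proof.
move=> Tf; elim: r => [|j r IH]; first by rewrite big_nil raddf0; exact: trace_ring0.
by rewrite big_cons raddfD /=; apply: trace_ring_add.
Qed.

Lemma word_mx_homog w p q : wmx w p q \is (size w).-homog.
Proof.
elim: w p q => [|l w IH] p q.
  by rewrite /word_mx big_nil mxE; case: eqP => _; rewrite ?dhomog1 ?dhomog0.
rewrite word_mx_cons mxE -[size _]/(1 + size w)%N.
apply: rpred_sum => s _; rewrite letter_mxE.
by apply: dhomogM => //; rewrite dhomogX /= mdeg1.
Qed.

Lemma hproj_homog_closed d e (f : poly) :
  f \is e.-homog -> TR f%:M -> TR (hproj d f)%:M.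
Proof.
move=> hf Tf; have [<-|de] := eqVneq e d; first by rewrite pihomog_dE.
by rewrite (pihomog_ne0 de) // raddf0; exact: trace_ring0.
Qed.

(** Traces of words are homogeneous and generate. *)
Lemma trace_ring_hproj d (f : poly) : TR f%:M -> TR (hproj d f)%:M.
Proof.
move=> Tf; move: d.
apply: (@Tcenter_ind R g n hn (fun f => forall d, TR (hproj d f)%:M) _ _ _ _ f Tf)
  => [c|w|a b Ha Hb|a b Ha Hb] d.
- apply: (@hproj_homog_closed _ 0%N).
    by rewrite -alg_mpolyC; apply: dhomogZ; exact: dhomog1.
  by rewrite -alg_mpolyC; exact: trace_ring_scalar.
- apply: (@hproj_homog_closed _ (size w)); last exact: trace_ring_trace.
  by apply: rpred_sum => p _; exact: word_mx_homog.
- by rewrite pihomogD raddfD /=; apply: trace_ring_add.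
rewrite (pihomog_partitionE (leqnn (mmeasure mdeg a))).
rewrite (pihomog_partitionE (leqnn (mmeasure mdeg b))).
rewrite mulr_suml (big_morph _ (pihomogD _ d) (pihomog0 _ _ d)).
apply: trace_ring_scalar_sum => i.
rewrite mulr_sumr (big_morph _ (pihomogD _ d) (pihomog0 _ _ d)).
apply: trace_ring_scalar_sum => j.
apply: (@hproj_homog_closed _ (i + j)); first by apply: dhomogM; exact: pihomogP.
by rewrite scalar_mxM; apply: trace_ring_mul.
Qed.

(** Orthogonal projection in the finite-dimensional space of forms of degree
    d, through orthonormal coordinates of the trace polynomials of that
    degree. *)
Lemma reynolds_homog d (q : poly) : q \is d.-homog ->
  exists t, [/\ TR t%:M, t \is d.-homog &
    forall h, TR h%:M -> h \is d.-homog -> fischer (q - t) h = 0].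
Proof.
move=> hq; pose W := {h : poly | TR h%:M /\ h \is d.-homog}.
pose G (u v : W) := fischer (sval u) (sval v).
pose lin k (s : 'I_k -> W) (x : 'rV[R]_k) : poly := \sum_i x 0 i *: sval (s i).
have linW k (s : 'I_k -> W) x : TR (lin k s x)%:M /\ lin k s x \is d.-homog.
  split; last by apply: rpred_sum => i _; apply: rpredZ; exact: (svalP (s i)).2.
  apply: trace_ring_scalar_sum => i; rewrite -mulr_algl scalar_mxM.
  by apply: trace_ring_mul; [exact: trace_ring_scalar | exact: (svalP (s i)).1].
have fischer_lin k (s : 'I_k -> W) x p :
    fischer (lin k s x) p = \sum_i x 0 i * fischer (sval (s i)) p.
  by rewrite fischer_suml; apply: eq_bigr => i _; rewrite fischerZl.
have [| | |m [s [c [cG Cu]]]]   :=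
  @gram_realization R W G #|{: 'X_{1..#|xi_index g n| < d.+1}}|.
- by move=> u v; exact: fischerC.
- move=> k s x; have -> : (x *m gram G s *m x^T) 0 0 = fischer (lin k s x) (lin k s x).
    rewrite fischer_sumr mxE; apply: eq_bigr => j _.
    rewrite fischerZr fischer_lin [RHS]mulrC [x^T _ _]mxE [(x *m _) _ _]mxE.
    by congr (_ * _); apply: eq_bigr => i _; rewrite mxE.
  exact: fischer_ge0.
- pose T : finType := 'X_{1..#|xi_index g n| < d.+1}.
  move=> k s kT; rewrite -[#|_|]/#|T| in kT.
  pose U : 'M[R]_(k, #|T|) := \matrix_(i, j) (sval (s i))@_(val (enum_val j)).
  pose U' : 'M[R]_(k, #|T|) :=
    \matrix_(i, j) ((sval (s i))@_(val (enum_val j)) *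
      (mnm_fact (val (enum_val j)))%:R).
  have GU : gram G s = U *m U'^T.
    apply/matrixP => i j; rewrite !mxE /G.
    rewrite /fischer (@mnm_lin_widen _ _ _ [seq val t | t <- enum T]); first last.
    + move=> mm hm; have dm := dhomog_mf (svalP (s i)).2 hm.
      apply/mapP; have ltd : (mdeg mm < d.+1)%N by rewrite /= in dm; rewrite dm.
      by exists (BMultinom ltd); rewrite ?mem_enum.
    + by rewrite map_inj_uniq ?enum_uniq //; exact: val_inj.
    rewrite big_map big_enum /= big_enum_val /=; apply: eq_bigr => t _.
    by rewrite !mxE.
  apply/eqP; rewrite -[_ == 0]negbK -unitfE -unitmxE -row_free_unit /row_free GU.
  apply: contraL kT => /eqP <-; rewrite -leqNgt.
  exact: leq_trans (mxrankM_maxl _ _) (rank_leq_col _).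
have su : gram G s \in unitmx.
  suff -> : gram G s = (\matrix_(i, j) c (s j) i 0)^T *m (\matrix_(i, j) c (s j) i 0).
    by rewrite unitmx_mul unitmx_tr Cu.
  apply/matrixP => i j; have /matrixP/(_ 0 0) := cG (s i) (s j).
  rewrite [gram _ _ _ _]mxE [X in _ = X -> _]mxE eqxx mulr1n => <-.
  by rewrite !mxE; apply: eq_bigr => k _; rewrite !mxE.
pose pr (p : poly) := lin m s ((\row_j fischer p (sval (s j))) *m invmx (gram G s)).
have pr_orth p j : fischer (p - pr p) (sval (s j)) = 0.
  rewrite fischerBl fischer_lin; apply/eqP; rewrite subr_eq0; apply/eqP.
  have := mulmxKV su (\row_j fischer p (sval (s j))).
  move/rowP/(_ j); rewrite [RHS]mxE mxE => <-.
  by apply: eq_bigr => i _; rewrite [gram _ _ _ _]mxE.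
have pr_id u : TR u%:M -> u \is d.-homog -> u = pr u.
  move=> Tu hu.
  have [Tp hp] := linW m s ((\row_j fischer u (sval (s j))) *m invmx (gram G s)).
  have zW : TR (u - pr u)%:M /\ (u - pr u) \is d.-homog.
    split; last exact: rpredB.
    rewrite raddfB /= -scaleN1r; apply: trace_ring_add => //.
    apply: trace_ring_poly_scale => //.
    by have := trace_ring_scalar g n (-1 : R); rewrite scaleN1r.
  pose z : W := exist _ _ zW.
  have cz : c z = 0.
    apply: trmx_inj; rewrite trmx0.
    apply: (can_inj (mulmxK Cu)); rewrite mul0mx; apply/rowP => j.
    have E : ((c z)^T *m c (s j)) 0 0 = 0 by rewrite cG /G /= pr_orth raddf0 mxE.
    rewrite [RHS]mxE -E [LHS]mxE [RHS]mxE.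
    by apply: eq_bigr => k _; rewrite !mxE.
  apply/eqP; rewrite -subr_eq0; apply/eqP/fischer_eq0.
  have /matrixP/(_ 0 0) := cG z z; rewrite cz mulmx0 !mxE mulr1n /G /=.
  by move=> <-.
have [Tp hp] := linW m s ((\row_j fischer q (sval (s j))) *m invmx (gram G s)).
exists (pr q); split=> // h Th hh.
rewrite [h]pr_id // fischerC fischer_lin big1 // => i _.
by rewrite fischerC pr_orth mulr0.
Qed.

(** Forms of different degrees are orthogonal and the trace polynomials form a
    graded space, so that projecting each homogeneous component suffices. *)
Lemma reynolds_exists (q : poly) : exists t, TR t%:M /\ perp (q - t).
Proof.
rewrite (pihomog_partitionE (leqnn (mmeasure mdeg q))).
elim/big_ind: _ => [|p p' [t [Tt pt]] [t' [Tt' pt']]|d _].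
- exists 0; rewrite raddf0 subr0; split; first exact: trace_ring0.
  by move=> h _; rewrite fischer0l.
- exists (t + t'); rewrite raddfD /= opprD addrACA; split; first exact: trace_ring_add.
  exact: perpD.
have hq := pihomogP (mdeg : measure _) d q.
have [t [Tt ht th]] := reynolds_homog hq.
exists t; split=> // h Th; rewrite {1}(pihomog_partitionE (leqnn (mmeasure mdeg h))).
rewrite fischer_sumr big1 // => e _.
have [ed|ed] := eqVneq (e : nat) d.
  by rewrite ed; apply: th; [exact: trace_ring_hproj|exact: pihomogP].
apply: (@fischer_homog _ _ d e); rewrite 1?eq_sym ?rpredB //; exact: pihomogP.
Qed.

Lemma perp_trace_ring_eq0 (t : poly) : TR t%:M -> perp t -> t = 0.
Proof. by move=> Tt pt; apply: fischer_eq0; apply: pt. Qed.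
End Reynolds.

(** * Residue fields *)

Definition proper_ideal_pred (A : comNzRingType) (J : A -> Prop) :=
  [/\ J 0, ~ J 1, forall x y, J x -> J y -> J (x + y) & forall a x, J x -> J (a * x)].

(** The empty set is admitted in the family to which Zorn's lemma is applied,
    because the union of the empty chain is empty. *)
Lemma maximal_ideal_exists (A : comNzRingType) (J : A -> Prop) :
  proper_ideal_pred J ->
  exists M : A -> Prop, [/\ proper_ideal_pred M, forall x, J x -> M x &
    forall x, ~ M x -> exists y, M (y * x - 1)].
Proof.
move=> hJ.
pose good (M : A -> Prop) := proper_ideal_pred M /\ forall x, J x -> M x.
have [M [PM Mmax]] : exists M : A -> Prop, (good M \/ (forall x, ~ M x)) /\
    forall B : A -> Prop, classical_sets.proper M B -> ~ (good B \/ (forall x, ~ B x)).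
  apply: classical_sets.Zorn_bigcup => C CP Ctot.
  have [[X0 CX0 gX0]|nC] := pselect (exists2 X, C X & good X); last first.
    right=> x [X CX Xx]; case: (CP X CX) => [gX|/(_ x) //].
    by apply: nC; exists X.
  left; split; last by move=> x Jx; exists X0 => //; apply: gX0.2.
  have [[X00 _ _ _] _] := gX0.
  split; first by exists X0.
  - move=> [X CX X1]; by case: (CP X CX) => [[[_ nX1 _ _] _]|/(_ 1) //]; apply: nX1.
  - move=> x y [X CX Xx] [Y CY Yy].
    case: (CP X CX) => [[[_ _ XD _] _]|/(_ x) //].
    case: (CP Y CY) => [[[_ _ YD _] _]|/(_ y) //].
    by case: (Ctot X Y CX CY) => XY; [exists Y => //; apply: YD => //; apply: XY
                                     |exists X => //; apply: XD => //; apply: XY].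
  - move=> a x [X CX Xx]; exists X => //.
    by case: (CP X CX) => [[[_ _ _ XM] _]|/(_ x) //]; apply: XM.
have gM : good M.
  case: PM => // M0; exfalso; apply: (Mmax J); last by left; split.
  by case: hJ => J0 _ _ _; split=> [x /M0 //|JM]; apply: (M0 0); apply: JM.
have [[M0 M1 MD MM] JM] := gM.
exists M; split=> // x nMx; apply: contrapT => nxy.
pose B z := exists2 m, M m & exists y, z = m + y * x.
apply: (Mmax B); last first.
  left; split; last by move=> z Jz; exists z;
    [exact: JM | exists 0; rewrite mul0r addr0].
  split.
  - by exists 0 => //; exists 0; rewrite mul0r addr0.
  - move=> [m Mm [y mE]]; apply: nxy; exists y.
    have -> : y * x - 1 = -1 * m.
      by apply/eqP; rewrite mulN1r subr_eq [X in _ == _ + X]mE addKr.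
    exact: MM.
  - move=> _ _ [m Mm [y ->]] [m' Mm' [y' ->]]; exists (m + m'); first exact: MD.
    by exists (y + y'); rewrite mulrDl addrACA.
  - move=> a _ [m Mm [y ->]]; exists (a * m); first exact: MM.
    by exists (a * y); rewrite mulrDr mulrA.
split=> [m Mm|BM]; first by exists m => //; exists 0; rewrite mul0r addr0.
by apply: nMx; apply: BM; exists 0 => //; exists 1; rewrite mul1r add0r.
Qed.

Section ResidueField.
Import ring_quotient generic_quotient.
Local Open Scope quotient_scope.
Variables (A : comNzRingType) (M : A -> bool).
Hypothesis M_ideal : idealr_closed M.
Hypothesis M_maximal : forall x, x \notin M -> exists y, y * x - 1 \in M.

HB.instance Definition _ := isIdealr.Build A M M_ideal.

Definition residue := {ideal_quot (M : idealr A)}.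
HB.instance Definition _ := GRing.ComNzRing.on residue.

Lemma residue_inv_exists (x : residue) : 
  exists y, (x != 0 -> y * x = 1) /\ (x = 0 -> y = 0).
Proof.
have [->|x0] := eqVneq x 0; first by exists 0.
have /M_maximal [y yx] : repr x \notin M.
  apply: contra x0 => rx; rewrite -[x]reprK -(rmorph0 (\pi_(residue))).
  by rewrite -Quotient.idealrBE subr0.
exists (\pi_(residue) y); split=> [_|x00]; last by rewrite x00 eqxx in x0.
rewrite -[x]reprK -rmorphM -(rmorph1 \pi_(residue)).
by apply/eqP; rewrite -Quotient.idealrBE.
Qed.

Definition residue_inv (x : residue) : residue := sval (cid (residue_inv_exists x)).

Lemma residue_mulVf (x : residue) : x != 0 -> residue_inv x * x = 1.
Proof. exact: (svalP (cid (residue_inv_exists x))).1. Qed.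

Lemma residue_invr0 : residue_inv 0 = 0.
Proof. exact: (svalP (cid (residue_inv_exists 0))).2. Qed.

HB.instance Definition _ :=
  GRing.ComNzRing_isField.Build residue residue_mulVf residue_invr0.

Lemma residue_field : exists (K : fieldType) (h : {rmorphism A -> K}),
  forall x, x \in M -> h x = 0.
Proof.
exists (residue : fieldType), (\pi_(residue) : {rmorphism A -> residue}) => x xM.
by apply/eqP; rewrite -(rmorph0 \pi_(residue)) -Quotient.idealrBE subr0.
Qed.
End ResidueField.

Lemma field_of_proper_ideal (A : comNzRingType) (J : A -> Prop) :
  proper_ideal_pred J ->
  exists (K : fieldType) (h : {rmorphism A -> K}), forall x, J x -> h x = 0.
Proof.
move=> /maximal_ideal_exists [M [[M0 M1 MD MM] JM Mmax]].
have [||K [h hM]] := @residue_field A (fun x => `[< M x >]).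
- split; [exact/asboolP|exact/asboolP|].
  by move=> a x y /asboolP Mx /asboolP My; apply/asboolP/MD => //; apply: MM.
- by move=> x /asboolP /Mmax [y My]; exists y; apply/asboolP.
by exists K, h => x /JM Mx; apply: hM; apply/asboolP.
Qed.

(** * Realization over a field extension *)

Section Point.
Variables (R : realType) (g n : nat).
Hypothesis hn : (0 < n)%N.
Local Notation poly := (xi_poly R g n).
Local Notation letter := ('I_g * bool)%type.
Local Notation wmx := (@word_mx R g n).
Local Notation TR := (@trace_ring R g n).
Local Notation perp := (@perp R g n).

Definition word_trace (w : seq letter) : Tcenter R g n :=
  MkTcenter (introT (Tcenter_predP (\tr (wmx w))) (@trace_ring_trace R g n w)).

Variables (S : rcfType) (iota : {rmorphism R -> S}).
Variable phi : {lrmorphism Tcenter R g n -> S | iota \; *%R}.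

(** The functional is phi after the Reynolds operator. *)
Lemma invariant_functional : exists Phi : poly -> S,
  [/\ forall p q, Phi (p + q) = Phi p + Phi q,
      forall c p, Phi (c *: p) = iota c * Phi p, Phi 1 = 1 &
      forall w q, Phi (\tr (wmx w) * q) = phi (word_trace w) * Phi q].
Proof.
pose rho q : poly := sval (cid (reynolds_exists hn q)).
have rhoP q : TR (rho q)%:M /\ perp (q - rho q) := svalP (cid (reynolds_exists hn q)).
have rho_uniq q t : TR t%:M -> perp (q - t) -> rho q = t.
  move=> Tt pt; have [Tr pr] := rhoP q.
  apply/eqP; rewrite -subr_eq0; apply/eqP/perp_trace_ring_eq0.
    rewrite raddfB /=; apply: trace_ring_add => //.
    rewrite -scaleN1r; apply: trace_ring_poly_scale => //.
    by have := trace_ring_scalar g n (-1 : R); rewrite scaleN1r.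
  move=> h Th; have -> : rho q - t = (q - t) - (q - rho q).
    by rewrite opprB [RHS]addrC addrA subrK.
  by rewrite fischerBl pt // pr // subrr.
have rho_in q : rho q \in Tcenter_pred R g n by apply/Tcenter_predP; case: (rhoP q).
pose Rho q : Tcenter R g n := MkTcenter (rho_in q).
have TRZ (c : R) (t : poly) : TR t%:M -> TR (c *: t)%:M.
  move=> Tt; rewrite -mulr_algl scalar_mxM; apply: trace_ring_mul => //.
  exact: trace_ring_scalar.
exists (fun q => phi (Rho q)); split.
- move=> p q; rewrite -raddfD; congr (phi _); apply: val_inj => /=.
  have [Tp pp] := rhoP p; have [Tq pq] := rhoP q.
  apply: rho_uniq; first by rewrite raddfD; apply: trace_ring_add.
  by rewrite opprD addrACA; apply: perpD.
- move=> c p; have -> : Rho (c *: p) = c *: Rho p.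
    apply: val_inj => /=; have [Tp pp] := rhoP p.
    apply: rho_uniq; first exact: TRZ.
    by move=> h Th; rewrite -scalerBr fischerZl pp // mulr0.
  by rewrite linearZ.
- have -> : Rho 1 = 1; last exact: rmorph1.
  apply: val_inj => /=; apply: rho_uniq; first exact: trace_ring1.
  by rewrite subrr => h _; rewrite fischer0l.
move=> w q; have -> : Rho (\tr (wmx w) * q) = word_trace w * Rho q.
  apply: val_inj => /=; have [Tq pq] := rhoP q.
  apply: rho_uniq.
    by rewrite scalar_mxM; apply: trace_ring_mul => //; apply: trace_ring_trace.
  by rewrite -mulrBr; apply: perp_trace.
by rewrite rmorphM.
Qed.

(** The largest ideal contained in the kernel of the functional extended to
    S[i][xi] is proper, since the functional takes the value 1 at 1, and it
    contains tr w - phi (tr w) because the functional is linear over traces. *)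
Theorem complex_point_exists : exists (K : fieldType) (kappa : {rmorphism S -> K})
    (iK : K) (X : letter -> 'M[K]_n),
  [/\ iK * iK = -1, forall l, X (flip_letter l) = (X l)^T &
      forall w, \tr (word_prod X w) = kappa (phi (word_trace w))].
Proof.
have [Phi [PhiD PhiZ Phi1 Phiw]] := invariant_functional.
pose N := #|xi_index g n|.
pose toC : {rmorphism S -> S[i]} := real_complex S.
have [PhiC [PhiC0 PhiCD PhiCZ PhiCX]] : exists PhiC : {mpoly S[i][N]} -> S[i],
    [/\ PhiC 0 = 0, forall p q, PhiC (p + q) = PhiC p + PhiC q,
        forall a p, PhiC (a *: p) = a * PhiC p &
        forall m, PhiC 'X_[m] = toC (Phi 'X_[m])].
  by exists (mnm_lin (fun m => toC (Phi 'X_[m]))); split; 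
    [exact: mnm_lin0|exact: mnm_linD|exact: mnm_linZ|exact: mnm_linX].
have [M [MZ MX]] : exists M : {rmorphism poly -> {mpoly S[i][N]}},
    (forall c p, M (c *: p) = toC (iota c) *: M p) /\ (forall m, M 'X_[m] = 'X_[m]).
  exists (map_mpoly (toC \o iota)).
  by split=> [c p|m]; [exact: map_mpolyZ|exact: map_mpolyX].
have Phi0 : Phi 0 = 0.
  by have := PhiZ 0 0; rewrite scale0r rmorph0 mul0r.
have Phi_map (p : poly) : PhiC (M p) = toC (Phi p).
  elim/mpolyind: p => [|c m p _ _ IH].
    by rewrite rmorph0 PhiC0 Phi0 rmorph0.
  by rewrite rmorphD PhiCD IH PhiD PhiZ rmorphD rmorphM MZ MX PhiCZ PhiCX.
pose J (p : {mpoly S[i][N]}) := forall r, PhiC (p * r) = 0.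
have J_ideal : proper_ideal_pred J.
  split.
  - by move=> r; rewrite mul0r PhiC0.
  - move=> /(_ 1); rewrite mulr1 -(rmorph1 M) Phi_map Phi1 rmorph1.
    by apply/eqP; rewrite oner_eq0.
  - by move=> p q Jp Jq r; rewrite mulrDl PhiCD Jp Jq addr0.
  - by move=> a p Jp r; rewrite mulrAC mulrC; exact: Jp.
have J_word w : J (M (\tr (wmx w)) - (toC (phi (word_trace w)))%:MP).
  elim/mpolyind => [|c m p _ _ IH]; first by rewrite mulr0 PhiC0.
  rewrite mulrDr PhiCD IH addr0 -scalerAr PhiCZ.
  rewrite mulrBl -scaleN1r PhiCD PhiCZ mul_mpolyC PhiCZ.
  have -> : 'X_[m] = M 'X_[m] by rewrite MX.
  by rewrite -rmorphM !Phi_map Phiw rmorphM mulN1r subrr mulr0.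
have [K [h hJ]] := field_of_proper_ideal J_ideal.
pose kappa : {rmorphism S -> K} := h \o (mpolyC N (R := S[i])) \o toC.
pose hf : {rmorphism poly -> K} := h \o M.
exists K, kappa, (h ('i%C)%:MP), (fun l => map_mx hf (letter_mx R n l)).
split.
- by rewrite -rmorphM -mpolyCM -expr2 sqr_i !rmorphN !rmorph1.
- by move=> l; rewrite map_trmx letter_mx_flip.
move=> w; transitivity (hf (\tr (wmx w))).
  rewrite -trace_map_mx; congr (\tr _); rewrite /word_prod /word_mx.
  elim: w => [|l w IH]; first by rewrite !big_nil map_mx1.
  by rewrite !big_cons map_mxM IH.
by have /eqP := hJ _ (J_word w); rewrite rmorphB subr_eq0 => /eqP.
Qed.
End Point.

(** * Realization over the real closed field *)

Section CoordinateOperators.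
Variables (F : rcfType) (W : Type) (G : W -> W -> F) (m : nat).
Variables (s : 'I_m -> W) (c : W -> 'cV[F]_m).
Hypothesis cG : forall u v, (c u)^T *m c v = (G u v)%:M.
Hypothesis c_unit : (\matrix_(i, j) c (s j) i 0) \in unitmx.

Lemma coord_combination (x : 'cV[F]_m) :
  exists y : 'I_m -> F, x = \sum_j y j *: c (s j).
Proof.
pose C := \matrix_(i, j) c (s j) i 0; pose y := invmx C *m x.
exists (fun j => y j 0); rewrite -[LHS](mulKVmx c_unit) -/C -/y.
apply/colP => i; rewrite mxE summxE; apply: eq_bigr => j _.
by rewrite !mxE mulrC.
Qed.

Lemma coord_ext (x y : 'cV[F]_m) :
  (forall u, (c u)^T *m x = (c u)^T *m y) -> x = y.
Proof.
move=> H; apply/eqP; rewrite -subr_eq0; apply/eqP.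
have [z zE] := coord_combination (x - y).
apply: trmx_inj; rewrite trmx0; apply: mulmx_tr_eq0; rewrite trmxK {1}zE.
rewrite raddf_sum mulmx_suml big1 // => j _ /=.
by rewrite linearZ /= -scalemxAl mulmxBr H subrr scaler0.
Qed.

Lemma coord_mx_ext (A B : 'M[F]_m) : (forall u, A *m c u = B *m c u) -> A = B.
Proof.
move=> H; apply: trmx_inj; apply/row_matrixP => j; rewrite -!tr_col !colE.
have [z ->] := coord_combination (delta_mx j 0); congr (_^T).
by rewrite !mulmx_sumr; apply: eq_bigr => k _; rewrite -!scalemxAr H.
Qed.

(** Linearity on coordinates is automatic: coordinates of f u are determined
    by their inner products, which are those of u with the coordinates of h v. *)
Lemma coord_operator (f h : W -> W) : (forall u v, G (f u) v = G u (h v)) ->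
  exists A : 'M[F]_m, forall u, A *m c u = c (f u).
Proof.
move=> adj; pose C := \matrix_(i, j) c (s j) i 0.
pose Cf := \matrix_(i, j) c (f (s j)) i 0.
have Gs u v : G u v = G v u.
  have := congr1 trmx (cG u v); rewrite trmx_mul trmxK cG tr_scalar_mx.
  by move/matrixP/(_ 0 0); rewrite !mxE.
have As j : Cf *m invmx C *m c (s j) = c (f (s j)).
  have -> : c (s j) = col j C by apply/colP => i; rewrite !mxE.
  rewrite colE mulmxA mulmxKV // -colE.
  by apply/colP => i; rewrite !mxE.
exists (Cf *m invmx C) => u; apply: coord_ext => v.
have [y uE] := coord_combination (c u).
rewrite [in LHS]uE !mulmx_sumr.
transitivity (\sum_j y j *: ((c (h v))^T *m c (s j))).
  by apply: eq_bigr => j _; rewrite -!scalemxAr As !cG Gs adj Gs.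
rewrite (eq_bigr (fun j => (c (h v))^T *m (y j *: c (s j)))) => [|j _]; last first.
  by rewrite scalemxAr.
by rewrite -mulmx_sumr -uE !cG Gs -adj Gs.
Qed.
End CoordinateOperators.

Section Words.
Variables (R : realType) (g n : nat).
Local Notation letter := ('I_g * bool)%type.
Local Notation wmx := (@word_mx R g n).

Definition flip_word (w : seq letter) := rev (map (@flip_letter g) w).

Lemma flip_letterK : involutive (@flip_letter g).
Proof. by case=> j b; rewrite /flip_letter /= negbK. Qed.

Lemma flip_wordK : involutive flip_word.
Proof.
move=> w; rewrite /flip_word map_rev revK -map_comp map_id_in // => l _.
exact: flip_letterK.
Qed.

Lemma flip_word_cat u v : flip_word (u ++ v) = flip_word v ++ flip_word u.
Proof. by rewrite /flip_word map_cat rev_cat. Qed.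

Lemma word_mx_cat u v : wmx (u ++ v) = wmx u *m wmx v.
Proof.
elim: u => [|l u IH]; first by rewrite /= {2}/word_mx big_nil mul1mx.
by rewrite cat_cons !word_mx_cons IH mulmxA.
Qed.

Lemma word_mx_flip w : wmx (flip_word w) = (wmx w)^T.
Proof.
elim: w => [|l w IH]; first by rewrite /word_mx !big_nil trmx1.
rewrite /flip_word /= rev_cons word_mx_rcons -/(flip_word w) IH.
by rewrite letter_mx_flip word_mx_cons trmx_mul.
Qed.

Lemma word_traceC (u v : seq letter) :
  word_trace R n (u ++ v) = word_trace R n (v ++ u).
Proof. by apply: val_inj; rewrite /= !word_mx_cat mxtrace_mulC. Qed.

Lemma word_trace_flip (w : seq letter) :
  word_trace R n (flip_word w) = word_trace R n w.
Proof. by apply: val_inj; rewrite /= word_mx_flip mxtrace_tr. Qed.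
End Words.

Section Realization.
Variables (R : realType) (g n : nat).
Local Notation letter := ('I_g * bool)%type.
Local Notation wmx := (@word_mx R g n.+1).
Local Notation flip := (@flip_letter g).
Variables (S : rcfType) (iota : {rmorphism R -> S}).
Variable phi : {lrmorphism Tcenter R g n.+1 -> S | iota \; *%R}.
Hypothesis phi_pos : forall (h : 'M[xi_poly R g n.+1]_n.+1) (Th : trace_ring h),
  0 <= phi (tr_mul_trmx Th).

Definition word_state (w : seq letter) : S := phi (word_trace R n.+1 w).
Definition word_form (u v : seq letter) : S := word_state (u ++ flip_word v).

Lemma word_form_sym u v : word_form u v = word_form v u.
Proof.
rewrite /word_form /word_state -word_trace_flip flip_word_cat flip_wordK //.
Qed.

(** For coefficients phi f_i, the value of the form is phi (tr (h h^t)), where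
    h is the sum of the f_i w_i. *)
Lemma word_form_psd k (s : 'I_k -> seq letter) : psd_mx (gram word_form s).
Proof.
apply: (@psd_mx_subring _ (fun x => exists f, x = phi f)).
- by exists 1; rewrite rmorph1.
- by move=> _ _ [f ->] [f' ->]; exists (f - f'); rewrite rmorphB.
- by move=> _ _ [f ->] [f' ->]; exists (f * f'); rewrite rmorphM.
- by apply/matrixP => i j; rewrite !mxE word_form_sym.
- by move=> i j; rewrite mxE; eexists.
move=> x /choice [f xE].
pose h := \sum_i val (f i) *: wmx (s i).
have Th : trace_ring h.
  rewrite /h; apply: big_ind => [|a b|i _]; first exact: trace_ring0.
    exact: trace_ring_add.
  apply: trace_ring_poly_scale; last exact: trace_ring_word.
  exact/Tcenter_predP/valP.
suff -> : (x *m gram word_form s *m x^T) 0 0 = phi (tr_mul_trmx Th) by [].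
have -> : tr_mul_trmx Th =
    \sum_j (\sum_i f i * word_trace R n.+1 (s i ++ flip_word (s j))) * f j.
  apply: val_inj => /=; pose V := @Tcenter_val R g n.+1.
  have VD : {morph V : a b / a + b} by [].
  have V0 : V 0 = 0 by [].
  have VM a b : V (a * b) = V a * V b by [].
  have hT : h^T = \sum_j V (f j) *: (wmx (s j))^T.
    by rewrite /h linear_sum; apply: eq_bigr => j _; rewrite linearZ.
  rewrite -/V (big_morph V VD V0) hT mulmx_sumr linear_sum.
  apply: eq_bigr => j _; rewrite VM (big_morph V VD V0) mulr_suml /=.
  rewrite -scalemxAr mxtraceZ mulrC /h mulmx_suml linear_sum mulr_suml.
  apply: eq_bigr => i _.
  by rewrite word_mx_cat word_mx_flip -scalemxAl /= mxtraceZ.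
rewrite raddf_sum mxE; apply: eq_bigr => j _ /=; rewrite rmorphM.
rewrite [x^T _ _]mxE xE; congr (_ * _); rewrite raddf_sum mxE /=.
by apply: eq_bigr => i _; rewrite mxE rmorphM xE.
Qed.

(** Over K the Gram matrix factors through the space of matrices. *)
Lemma word_form_bound (K : fieldType) (kappa : {rmorphism S -> K})
    (X : letter -> 'M[K]_n.+1) :
  (forall l, X (flip l) = (X l)^T) ->
  (forall w, \tr (word_prod X w) = kappa (word_state w)) ->
  forall k (s : 'I_k -> seq letter), (n.+1 * n.+1 < k)%N ->
    \det (gram word_form s) = 0.
Proof.
move=> Xf Xt k s kn; apply: (fmorph_inj kappa); rewrite rmorph0 -det_map_mx.
have Xflip w : word_prod X (flip_word w) = (word_prod X w)^T.
  elim: w => [|l w IH]; first by rewrite !word_prod_nil trmx1.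
  rewrite /flip_word /= rev_cons -cats1 word_prod_cat -/(flip_word w) IH.
  by rewrite !word_prod_cons word_prod_nil mulmx1 Xf trmx_mul.
pose U : 'M[K]_(k, n.+1 * n.+1) := \matrix_i mxvec (word_prod X (s i)).
have -> : map_mx kappa (gram word_form s) = U *m U^T.
  apply/matrixP => i j; rewrite !mxE -Xt word_prod_cat Xflip.
  rewrite [RHS](reindex _ (curry_mxvec_bij _ _)) /=.
  transitivity (\sum_p \sum_q word_prod X (s i) p q * word_prod X (s j) p q).
    by apply: eq_bigr => p _; rewrite mxE; apply: eq_bigr => q _; rewrite mxE.
  rewrite pair_bigA; apply: eq_bigr => -[p q] _ /=.
  by rewrite !mxE !mxvecE.
apply/eqP; rewrite -[_ == 0]negbK -unitfE -unitmxE -row_free_unit /row_free.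
apply: contraL kn => /eqP <-; rewrite -leqNgt.
exact: leq_trans (mxrankM_maxl _ _) (rank_leq_col _).
Qed.

(** Left multiplication of words commutes with right multiplication, and the
    latter, which generates the commutant of the former, is what lifts to X. *)
Theorem word_state_realizable :
  exists Y : letter -> 'M[S]_n.+1,
    (forall l, Y (flip l) = (Y l)^T) /\
    forall w, \tr (word_prod Y w) = word_state w.
Proof.
have [K [kappa [iK [X [ii Xf Xt]]]]] := complex_point_exists (ltn0Sn n) phi.
have bnd := word_form_bound Xf Xt.
have [m [s [c [cG Cu]]]] := gram_realization word_form_sym word_form_psd bnd.
have state_nil : word_state [::] = n.+1%:R.
  rewrite /word_state; have -> : word_trace R n.+1 ([::] : seq letter) = n.+1%:R.
    have val_nat k : Tcenter_val (k%:R : Tcenter R g n.+1) = k%:R.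
      by elim: k => // k IH; rewrite [RHS]mulrS -IH [in LHS]mulrS.
    by apply: val_inj; rewrite /= val_nat /word_mx big_nil mxtrace1.
  by rewrite rmorph_nat.
case: m s c cG Cu => [|m] s c cG Cu.
  have /matrixP/(_ 0 0) := cG [::] [::]; rewrite mxE big_ord0 mxE eqxx mulr1n.
  by move/esym/eqP; rewrite /word_form state_nil pnatr_eq0.
have state_cat u v : word_state (u ++ v) = word_state (v ++ u).
  by rewrite /word_state word_traceC.
have state_flip w : word_state (flip_word w) = word_state w.
  by rewrite /word_state word_trace_flip.
have flip1 l : flip_word [:: l] = [:: flip l] by [].
have adjL l u v : word_form (l :: u) v = word_form u (flip l :: v).
  rewrite /word_form -cat1s -[flip l :: v]cat1s flip_word_cat flip1 flip_letterK.
  by rewrite -catA state_cat catA.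
have adjQ l u v : word_form (rcons u (flip l)) v = word_form u (rcons v l).
  by rewrite /word_form -!cats1 flip_word_cat flip1 catA.
have /choice [L LE] : forall l, exists A : 'M_m.+1, forall u, A *m c u = c (l :: u).
  by move=> l; exact: (coord_operator cG Cu (adjL l)).
have /choice [Q QE] : forall l,
    exists A : 'M_m.+1, forall u, A *m c u = c (rcons u (flip l)).
  by move=> l; exact: (coord_operator cG Cu (adjQ l)).
have LT l : L (flip l) = (L l)^T.
  apply: (coord_mx_ext Cu) => v; apply: (coord_ext Cu) => u.
  by rewrite LE cG -adjL mulmxA -trmx_mul LE cG.
have QT l : Q (flip l) = (Q l)^T.
  apply: (coord_mx_ext Cu) => v; apply: (coord_ext Cu) => u.
  by rewrite QE flip_letterK cG -adjQ mulmxA -trmx_mul QE cG.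
have LQ l l' : L l *m Q l' = Q l' *m L l.
  by apply: (coord_mx_ext Cu) => u; rewrite -!mulmxA QE !LE QE.
have Lw v u : word_prod L v *m c u = c (v ++ u).
  rewrite /word_prod; elim: v => [|l v IH]; first by rewrite big_nil mul1mx.
  by rewrite big_cons -mulmxA IH LE.
have Qw v u : word_prod Q v *m c u = c (u ++ flip_word v).
  rewrite /word_prod; elim: v u => [|l v IH] u; first by rewrite big_nil mul1mx cats0.
  by rewrite big_cons -mulmxA IH QE /flip_word /= rev_cons rcons_cat.
pose w0 := c [::].
have tauL v : vstate w0 (word_prod L v) = word_state v.
  by rewrite /vstate -mulmxA Lw cats0 cG mxE eqxx mulr1n /word_form state_flip.
have tauQ v : vstate w0 (word_prod Q v) = word_state v.
  by rewrite /vstate -mulmxA Qw cG mxE eqxx mulr1n /word_form flip_wordK.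
have LQw v : commutant L (word_prod Q v).
  rewrite /word_prod; elim: v => [|l v IH]; first by rewrite big_nil; exact: commutant1.
  by rewrite big_cons; apply: commutantM => // l'; exact: LQ.
(* w0 is cyclic for L, so that T is determined by T w0 *)
have commE T : commutant L T ->
    exists y : 'I_m.+1 -> S, T = \sum_j y j *: word_prod Q (flip_word (s j)).
  move=> cT; have [y yE] := coord_combination Cu (T *m w0).
  exists y; apply: (coord_mx_ext Cu) => u.
  have <- : word_prod L u *m w0 = c u by rewrite Lw cats0.
  rewrite mulmxA -(word_prod_commute _ cT) -mulmxA yE mulmx_suml mulmx_sumr.
  apply: eq_bigr => j _; rewrite -scalemxAl -scalemxAr; congr (_ *: _).
  by rewrite !Lw Qw flip_wordK cats0.
have tauC A B : commutant L A -> commutant L B ->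
    vstate w0 (A *m B) = vstate w0 (B *m A).
  move=> /commE [y ->] /commE [z ->].
  rewrite !mulmx_suml !vstate_sum.
  under eq_bigr do rewrite mulmx_sumr vstate_sum.
  under [in RHS]eq_bigr do rewrite mulmx_sumr vstate_sum.
  rewrite exchange_big; apply: eq_bigr => i _; apply: eq_bigr => j _ /=.
  rewrite -!scalemxAr -!scalemxAl !vstateZ -!word_prod_cat !tauQ state_cat; ring.
have cyc (v : 'cV_m.+1) : exists2 A, commutant L A & A *m w0 = v.
  have [y ->] := coord_combination Cu v.
  exists (\sum_j y j *: word_prod Q (flip_word (s j))).
    apply: big_ind => [|A B|j _]; [exact: commutant0|exact: commutantD|].
    exact: commutantZ.
  rewrite mulmx_suml; apply: eq_bigr => j _.
  by rewrite -scalemxAl Qw flip_wordK.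
have lift T : commutant L T -> exists Z,
    lifted X (fun l => map_mx kappa (Q l)) Z (map_mx kappa T).
  move=> /commE [y ->].
  exists (\sum_j kappa (y j) *: word_prod X (flip_word (s j))).
  rewrite raddf_sum; apply: (big_ind2 (lifted X (fun l => map_mx kappa (Q l)))).
  - by have := liftedZ 0 (lifted1 X (fun l => map_mx kappa (Q l))); rewrite !scale0r.
  - by move=> *; apply: liftedD.
  move=> j _; rewrite /= map_mxZ; apply: liftedZ.
  rewrite /word_prod; elim: (flip_word (s j)) => [|l v IH].
    by rewrite !big_nil map_mx1; exact: lifted1.
  by rewrite !big_cons map_mxM; apply: liftedM => //; exact: lifted_gen.
have Hint := liftings_divisibility ii Xf LT QT _ tauC cyc lift.
have [|k [Y [YT Yt]]] := tracial_realizable LT tauC cyc (Hint _).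
  by move=> v; rewrite tauQ Xt.
have kn : k = n.+1.
  apply/eqP; rewrite -(eqr_nat S) -state_nil -tauL -Yt /word_prod big_nil.
  by rewrite mxtrace1.
by subst k; exists Y; split=> // w; rewrite Yt tauL.
Qed.

(** Evaluate the variables at the entries of Y; agreement with phi on traces
    of words propagates to the trace polynomials. *)
Lemma realization_extends (Y : letter -> 'M[S]_n.+1) :
  (forall l, Y (flip l) = (Y l)^T) ->
  (forall w, \tr (word_prod Y w) = word_state w) ->
  exists psi : {lrmorphism xi_poly R g n.+1 -> S | iota \; *%R},
     forall f : Tcenter R g n.+1, psi (val f) = phi f.
Proof.
move=> Yf Yt.
pose ev (i : 'I_#|xi_index g n.+1|) : S :=
  let: (j, p, q) := enum_val i in Y (j, false) p q.
pose f := mmap iota ev.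
have f_scale : scalable_for (iota \; *%R) f by move=> a p; rewrite /f mmapZ.
pose f_lin := GRing.isScalable.Build R (xi_poly R g n.+1) S (iota \; *%R) f f_scale.
pose psi : {lrmorphism xi_poly R g n.+1 -> S | iota \; *%R} := HB.pack f f_lin.
have psi_letter l : map_mx psi (letter_mx R n.+1 l) = Y l.
  have psiX j p q : psi (xi R j p q) = Y (j, false) p q.
    by rewrite /= /f mmapX mmap1U /ev enum_rankK.
  apply/matrixP => p q; case: l => j []; rewrite /letter_mx /generic_mx !mxE psiX //.
  by rewrite (Yf (j, false)) mxE.
have psi_word w : psi (\tr (wmx w)) = word_state w.
  rewrite -Yt -trace_map_mx; congr (\tr _).
  elim: w => [|l w IH]; first by rewrite word_prod_nil /word_mx big_nil map_mx1.
  by rewrite word_mx_cons word_prod_cons map_mxM IH psi_letter.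
have psiD a b : psi (a + b) = psi a + psi b by exact: rmorphD.
have psiM a b : psi (a * b) = psi a * psi b by exact: rmorphM.
exists psi => F.
have TF : trace_ring (val F)%:M by exact/Tcenter_predP/valP.
suff [F' [FF' E]] : exists F', val F' = val F /\ psi (val F) = phi F'.
  by rewrite E; congr (phi _); apply: val_inj.
apply: (@Tcenter_ind R g n.+1 (ltn0Sn n)
      (fun f => exists F', val F' = f /\ psi f = phi F') _ _ _ _ _ TF)
  => [c|w|a b [Fa [<- Ea]] [Fb [<- Eb]]|a b [Fa [<- Ea]] [Fb [<- Eb]]].
- exists (c%:A); split; first by rewrite /= -alg_mpolyC.
  by rewrite -alg_mpolyC !linearZ !rmorph1.
- by exists (word_trace R n.+1 w).
- by exists (Fa + Fb); split=> //; rewrite psiD Ea Eb rmorphD.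
- by exists (Fa * Fb); split=> //; rewrite psiM Ea Eb rmorphM.
Qed.
End Realization.

(* S is a real closed field extending the reals R through iota; the R-algebra
   structure on S is a . s := iota a * s. *)
Theorem theorem3 (R : realType) (g n : nat) (hn : (0 < n)%N)
    (S : rcfType) (iota : {rmorphism R -> S})
    (phi : {lrmorphism Tcenter R g n -> S | iota \; *%R}) :
  (exists psi : {lrmorphism xi_poly R g n -> S | iota \; *%R},
     forall f : Tcenter R g n, psi (val f) = phi f)
  <->
  (forall (h : 'M[xi_poly R g n]_n) (Th : trace_ring h),
     0 <= phi (tr_mul_trmx Th)).
Proof.
split=> [[psi psiE] h Th|phi_pos].
  rewrite -psiE /= raddf_sum; apply: sumr_ge0 => p _.
  rewrite mxE raddf_sum; apply: sumr_ge0 => q _ /=.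
  by rewrite mxE rmorphM -expr2 sqr_ge0.
case: n hn phi phi_pos => // n _ phi phi_pos.
have [Y [Yf Yt]] := word_state_realizable phi_pos.
exact: realization_extends Yf Yt.
Qed.
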